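(* Let $\mathbb{K}\in\{\mathbb{C},\mathbb{H}\}$, let $B$ be a compact manifold, let $\varphi:B\to\mathbb{KP}^{N-1}$ be an immersion, and endow $B$ with the pull-back metric. Let $\nabla$ be the connection on the $\mathbb{K}^1$-vector bundle $E\to B$ obtained by pulling back, via $\varphi$, the universal connection in the universal $\mathbb{K}^1$-bundle over $\mathbb{KP}^{N-1}$. Then $\nabla$ is parallel if and only if $$\langle S_{(\mathfrak{J}X)^\perp}Y - S_{(\mathfrak{J}Y)^\perp}X,\,Z\rangle = 0$$ for all $p\in B$, all $X,Y,Z\in T_pB\cong\varphi_*(T_pB)$ and all $\mathfrak{J}\in\mathrm{span}\{\mathcal{J}\}$, where $\perp$ denotes the component orthogonal to $\varphi_*(T_pB)$. Furthermore, $\nabla$ is radially symmetric if and only if $$\langle S_{(\mathfrak{J}X)^\perp}Y - S_{(\mathfrak{J}Y)^\perp}X,\,X\rangle = 0$$ for all $p\in B$, all $X,Y\in T_pB\cong\varphi_*(T_pB)$ and all $\mathfrak{J}\in\mathrm{span}\{\mathcal{J}\}$.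
   Context: Universal bundle and connection: $\mathbb{KP}^{N-1}$ is the Grassmannian of $1$-dimensional $\mathbb{K}$-linear subspaces of $\mathbb{K}^N$, with its standard metric (Fubini–Study, respectively its quaternionic analogue, up to scale). The universal vector bundle over it has total space $\{(\sigma,V)\mid \sigma\in\mathbb{KP}^{N-1},\ V\in\sigma\}$ and projection $(\sigma,V)\mapsto\sigma$. The universal connection is the one for which the covariant derivative of a section $t\mapsto(\sigma(t),V(t))$ along a curve is $t\mapsto(\sigma(t),V'(t)^{\sigma(t)})$, where the superscript denotes orthogonal projection onto $\sigma(t)$. $\mathcal{J}=\{J\}$ if $\mathbb{K}=\mathbb{C}$, where $J$ is the standard almost complex structure on $\mathbb{CP}^{N-1}$; $\mathcal{J}=\{I,J,K\}$ if $\mathbb{K}=\mathbb{H}$, where $\{I,J,K\}$ is a local basis for the standard almost quaternionic structure on $\mathbb{HP}^{N-1}$. The span is the real span. $II$ is the second fundamental form of $\varphi(B)$ and $S$ is the shape operator: for $p\in B$, $X,Y\in T_pB\cong\varphi_*(T_pB)$ and $\eta\perp\varphi_*(T_pB)$, $\langle S_\eta X,Y\rangle=\langle II(X,Y),\eta\rangle$. Let $R^\nabla$ be the curvature tensor of $\nabla$ and $DR^\nabla$ its covariant derivative (defined using $\nabla$ and the Levi-Civita connection of $B$). $\nabla$ is parallel if $(D_ZR^\nabla)(X,Y)W=0$ for all $p\in B$, all $X,Y,Z\in T_pB$ and all $W\in E_p$. $\nabla$ is radially symmetric if $(D_XR^\nabla)(X,Y)W=0$ for all $p\in B$, all $X,Y\in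 T_pB$ and all $W\in E_p$. *)

(* Defs.v *)
From HB Require Import structures.
From mathcomp Require Import all_boot all_order all_algebra.
From mathcomp Require Import all_classical all_reals all_analysis.

Set Implicit Arguments.
Unset Strict Implicit.
Unset Printing Implicit Defensive.

Import Order.TTheory GRing.Theory Num.Theory.
Import numFieldNormedType.Exports.

Local Open Scope classical_set_scope.
Local Open Scope ring_scope.

(* ------------------------------------------------------------------------ *)
(* Calculus on open subsets of R^n                                          *)
(* ------------------------------------------------------------------------ *)

Section Calculus.
Context {R : realType} {n : nat}.

(* Matrix-valued functions are differentiated entrywise. *)
Definition dmx {p q : nat} (F : 'rV[R]_n -> 'M[R]_(p, q)) (x v : 'rV[R]_n) :
    'M[R]_(p, q) :=
  \matrix_(a, b) 'D_v (fun y => F y a b) x.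

Fixpoint Ck (k : nat) (U : set 'rV[R]_n) (f : 'rV[R]_n -> R) : Prop :=
  if k is k'.+1 then
    (forall x, U x -> differentiable f x) /\
    (forall v : 'rV[R]_n, Ck k' U (fun x => 'D_v f x))
  else forall x, U x -> {for x, continuous f}.

Definition smooth_on {p q : nat} (U : set 'rV[R]_n)
    (F : 'rV[R]_n -> 'M[R]_(p, q)) : Prop :=
  forall a b k, Ck k U (fun x => F x a b).

Definition smooth_near {p q : nat} (x : 'rV[R]_n)
    (F : 'rV[R]_n -> 'M[R]_(p, q)) : Prop :=
  exists U : set 'rV[R]_n, [/\ open U, U x & smooth_on U F].

Definition lie_bracket (X Y : 'rV[R]_n -> 'rV[R]_n) (x : 'rV[R]_n) :
    'rV[R]_n :=
  dmx Y x (X x) - dmx X x (Y x).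

End Calculus.

(* ------------------------------------------------------------------------ *)
(* Smooth manifolds                                                         *)
(* ------------------------------------------------------------------------ *)

(* [cpar] is the inverse of [ccoord]; both are total functions whose values
   matter only on [cdom], respectively on [cimg]. *)
Record chart (R : realType) (n : nat) (B : topologicalType) := Chart {
  cdom : set B;
  ccoord : B -> 'rV[R]_n;
  cpar : 'rV[R]_n -> B }.

Definition cimg (R : realType) n B (c : chart R n B) : set 'rV[R]_n :=
  ccoord c @` cdom c.

Definition is_chart (R : realType) n B (c : chart R n B) : Prop :=
  [/\ open (cdom c), open (cimg c),
      (forall p, cdom c p -> cpar c (ccoord c p) = p),
      (forall p, cdom c p -> {for p, continuous (ccoord c)}) &
      (forall x, cimg c x -> {for x, continuous (cpar c)})].

Definition compatible (R : realType) n B (c c' : chart R n B) : Prop :=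
  smooth_on (ccoord c @` (cdom c `&` cdom c'))
            (fun x => ccoord c' (cpar c x)).

Record manifold (R : realType) (n : nat) (B : topologicalType) := Manifold {
  atlas : set (chart R n B);
  man_hausdorff : hausdorff_space B;
  man_second_countable : @second_countable B;
  man_chart : forall c, atlas c -> is_chart c;
  man_cover : forall p, exists2 c, atlas c & cdom c p;
  man_compatible : forall c c', atlas c -> atlas c' -> compatible c c' }.

(* ------------------------------------------------------------------------ *)
(* Riemannian geometry in coordinates                                       *)
(* ------------------------------------------------------------------------ *)

Definition bform (R : realType) n (G : 'M[R]_n) (u v : 'rV[R]_n) : R :=
  (u *m G *m v^T) 0 0.

(* The point of the subspace [S] from which [v] differs by a vector that is
   [ip]-orthogonal to [S]; it is unique when [ip] is an inner product. *)
Definition oproj (R : realType) (V : zmodType) (ip : V -> V -> R)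
    (S : set V) (v : V) : V :=
  xget 0 [set u | S u /\ forall s, S s -> ip (v - u) s = 0].

Section LeviCivita.
Context {R : realType} {n : nat} (g : 'rV[R]_n -> 'M[R]_n).

Definition dmetric (x : 'rV[R]_n) (l i j : 'I_n) : R :=
  'D_(delta_mx 0 l) (fun y => g y i j) x.

Definition christoffel (x : 'rV[R]_n) (i j k : 'I_n) : R :=
  2^-1 * \sum_l invmx (g x) k l *
    (dmetric x i j l + dmetric x j i l - dmetric x l i j).

Definition christoffel_map (x u v : 'rV[R]_n) : 'rV[R]_n :=
  \row_k \sum_i \sum_j christoffel x i j k * u 0 i * v 0 j.

Definition covd (X Y : 'rV[R]_n -> 'rV[R]_n) (x : 'rV[R]_n) : 'rV[R]_n :=
  dmx Y x (X x) + christoffel_map x (X x) (Y x).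

End LeviCivita.

Section Submanifold.
Context {R : realType} {n q : nat}.
Variables (h : 'rV[R]_q -> 'M[R]_q) (f : 'rV[R]_n -> 'rV[R]_q).

Definition pullback_metric (x : 'rV[R]_n) : 'M[R]_n :=
  \matrix_(j, k)
    bform (h (f x)) (dmx f x (delta_mx 0 j)) (dmx f x (delta_mx 0 k)).

Definition covd_along (V : 'rV[R]_n -> 'rV[R]_q) (x u : 'rV[R]_n) :
    'rV[R]_q :=
  dmx V x u + christoffel_map h (f x) (dmx f x u) (V x).

Definition normal_part (x : 'rV[R]_n) (xi : 'rV[R]_q) : 'rV[R]_q :=
  xi - oproj (bform (h (f x))) (range (dmx f x)) xi.

(* [v] is extended to the vector field with constant coordinates. *)
Definition second_ff (x u v : 'rV[R]_n) : 'rV[R]_q :=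
  normal_part x (covd_along (fun y => dmx f y v) x u).

Definition shape (x : 'rV[R]_n) (eta : 'rV[R]_q) (u : 'rV[R]_n) : 'rV[R]_n :=
  xget 0 [set s | forall v, bform (pullback_metric x) s v =
                            bform (h (f x)) (second_ff x u v) eta].

End Submanifold.

(* ------------------------------------------------------------------------ *)
(* Projective spaces over the complex numbers and the quaternions           *)
(* ------------------------------------------------------------------------ *)

Inductive scalars := Complex | Quaternion.

Definition kdim (K : scalars) : nat :=
  match K with Complex => 2 | Quaternion => 4 end.

(* Scalars are given by their real coordinates in the bases (1, i) and
   (1, i, j, k) respectively. *)
Notation kscal R K := ('rV[R]_(kdim K)).

Definition cmul (R : realType) (x y : 'rV[R]_2) : 'rV[R]_2 :=
  \row_a [:: x 0 0 * y 0 0 - x 0 1 * y 0 1;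
             x 0 0 * y 0 1 + x 0 1 * y 0 0]`_a.

Definition hmul (R : realType) (x y : 'rV[R]_4) : 'rV[R]_4 :=
  \row_a [:: x 0 0 * y 0 0 - x 0 1 * y 0 1 - x 0 2 * y 0 2 - x 0 3 * y 0 3;
             x 0 0 * y 0 1 + x 0 1 * y 0 0 + x 0 2 * y 0 3 - x 0 3 * y 0 2;
             x 0 0 * y 0 2 - x 0 1 * y 0 3 + x 0 2 * y 0 0 + x 0 3 * y 0 1;
             x 0 0 * y 0 3 + x 0 1 * y 0 2 - x 0 2 * y 0 1 + x 0 3 * y 0 0]`_a.

Definition kmul (R : realType) (K : scalars) :
    kscal R K -> kscal R K -> kscal R K :=
  match K with Complex => @cmul R | Quaternion => @hmul R end.

Definition kbasis (R : realType) (K : scalars) (a : nat) : kscal R K :=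
  \row_b ((b : nat) == a)%:R.

(* The right K-module K^N: row [k] holds the real coordinates of the k-th
   component. *)
Notation kvec R K N := ('M[R]_(N, kdim K)).

Definition kscale (R : realType) (K : scalars) (N : nat) (v : kvec R K N)
    (s : kscal R K) : kvec R K N :=
  \matrix_(k, a) kmul (row k v) s 0 a.

Definition dotK (R : realType) (K : scalars) (N : nat) (v w : kvec R K N) : R :=
  \sum_k \sum_a v k a * w k a.

Definition kline (R : realType) (K : scalars) (N : nat) (w : kvec R K N) :
    set (kvec R K N) :=
  [set v | exists s, v = kscale w s].

Definition kproj (R : realType) (K : scalars) (m : nat) :=
  {sigma : set (kvec R K m.+1) | exists2 w, w != 0 & sigma = kline w}.

Section Projective.
Context {R : realType} {K : scalars} {m : nat}.
Local Notation q := (m * kdim K)%N.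
Local Notation KN := (kvec R K m.+1).

(* The vector with i-th component 1 and remaining components listed by [z]:
   inhomogeneous coordinates on the lines not contained in {v | v_i = 0}. *)
Definition aff (i : 'I_m.+1) (z : 'rV[R]_q) : KN :=
  \matrix_(k, a) if unlift i k is Some j then vec_mx z j a
                 else kbasis R K 0 0 a.

Definition kp_dom (i : 'I_m.+1) (sigma : kproj R K m) : Prop :=
  exists z, sval sigma = kline (aff i z).

Definition kp_coord (i : 'I_m.+1) (sigma : kproj R K m) : 'rV[R]_q :=
  xget 0 [set z | sval sigma = kline (aff i z)].

(* The tangent space of KP^m at sigma = w K is Hom_K(sigma, sigma^perp), and
   a variation w' of w represents the homomorphism sending w to the component
   of w' orthogonal to sigma; its squared norm is |w'^perp|^2 / |w|^2.
   [kappa] is the scale of the metric. *)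
Definition fs_metric (kappa : R) (i : 'I_m.+1) (z : 'rV[R]_q) : 'M[R]_q :=
  let w := aff i z in
  let perp v := v - oproj (@dotK R K m.+1) (kline w) v in
  \matrix_(a, b) (kappa *
    dotK (perp (dmx (aff i) z (delta_mx 0 a)))
         (perp (dmx (aff i) z (delta_mx 0 b))) / dotK w w).

(* In Hom_K(sigma, sigma^perp) = sigma^perp (evaluation at w = aff i z) the
   structures are the right multiplications by i, respectively by i, j, k;
   since w has constant i-th component these are the right multiplications of
   the inhomogeneous coordinates.  Another choice of w rotates the quaternionic
   basis and leaves its real span unchanged. *)
Definition acs (a : nat) (u : 'rV[R]_q) : 'rV[R]_q :=
  mxvec (kscale (vec_mx u) (kbasis R K a.+1)).

Definition acs_span (t : 'I_(kdim K).-1 -> R) (u : 'rV[R]_q) : 'rV[R]_q :=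
  \sum_a t a *: acs a u.

End Projective.

(* ------------------------------------------------------------------------ *)
(* The pulled-back universal connection and its curvature                   *)
(* ------------------------------------------------------------------------ *)

Section Connection.
Context {R : realType} {K : scalars} {n N : nat}.
Variables (g : 'rV[R]_n -> 'M[R]_n) (sigma : 'rV[R]_n -> set (kvec R K N)).

Implicit Types (X Y Z : 'rV[R]_n -> 'rV[R]_n) (W : 'rV[R]_n -> kvec R K N).

Definition is_section (x : 'rV[R]_n) W : Prop :=
  smooth_near x W /\ \forall y \near x, sigma y (W y).

Definition conn X W (x : 'rV[R]_n) : kvec R K N :=
  oproj (@dotK R K N) (sigma x) (dmx W x (X x)).

Definition curv X Y W (x : 'rV[R]_n) : kvec R K N :=
  conn X (conn Y W) x - conn Y (conn X W) x - conn (lie_bracket X Y) W x.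

Definition Dcurv Z X Y W (x : 'rV[R]_n) : kvec R K N :=
  conn Z (curv X Y W) x - curv (covd g Z X) Y W x
  - curv X (covd g Z Y) W x - curv X Y (conn Z W) x.

End Connection.

(* ------------------------------------------------------------------------ *)
(* Maps from a manifold to KP^m                                             *)
(* ------------------------------------------------------------------------ *)

Section Maps.
Context {R : realType} {K : scalars} {m n : nat} {B : topologicalType}.
Variables (M : manifold R n B) (phi : B -> kproj R K m) (kappa : R).

Definition charts_at (p : B) (c : chart R n B) (i : 'I_m.+1) : Prop :=
  [/\ atlas M c, cdom c p & kp_dom i (phi p)].

Definition local_rep (c : chart R n B) (i : 'I_m.+1) (x : 'rV[R]_n) :
    'rV[R]_(m * kdim K) :=
  kp_coord i (phi (cpar c x)).

Definition smooth_map : Prop :=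
  forall p c i, charts_at p c i ->
  exists U : set 'rV[R]_n,
    [/\ open U, U (ccoord c p), U `<=` cimg c,
        (forall x, U x -> kp_dom i (phi (cpar c x))) &
        smooth_on U (local_rep c i)].

Definition immersion : Prop :=
  smooth_map /\
  forall p c i, charts_at p c i -> injective (dmx (local_rep c i) (ccoord c p)).

Definition induced_metric (c : chart R n B) (i : 'I_m.+1) :
    'rV[R]_n -> 'M[R]_n :=
  pullback_metric (fs_metric kappa i) (local_rep c i).

(* The fibre of E = phi^* (universal bundle) is the line phi p itself. *)
Definition fibre (c : chart R n B) (x : 'rV[R]_n) : set (kvec R K m.+1) :=
  sval (phi (cpar c x)).

(* The covariant derivative of the curvature is tensorial, so its vanishing on
   vectors is expressed by its vanishing on local fields and sections. *)
Definition parallel_conn : Prop :=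
  forall p c i, charts_at p c i ->
  forall (X Y Z : 'rV[R]_n -> 'rV[R]_n) (W : 'rV[R]_n -> kvec R K m.+1),
    smooth_near (ccoord c p) X -> smooth_near (ccoord c p) Y ->
    smooth_near (ccoord c p) Z -> is_section (fibre c) (ccoord c p) W ->
    Dcurv (induced_metric c i) (fibre c) Z X Y W (ccoord c p) = 0.

Definition radially_symmetric_conn : Prop :=
  forall p c i, charts_at p c i ->
  forall (X Y : 'rV[R]_n -> 'rV[R]_n) (W : 'rV[R]_n -> kvec R K m.+1),
    smooth_near (ccoord c p) X -> smooth_near (ccoord c p) Y ->
    is_section (fibre c) (ccoord c p) W ->
    Dcurv (induced_metric c i) (fibre c) X X Y W (ccoord c p) = 0.

(* The form < S_{(JJ X)^perp} Y - S_{(JJ Y)^perp} X , Z >, where JJ is the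
   element of the span of the structures with coefficients [t], at the point
   with coordinates [x]. *)
Definition shape_form (c : chart R n B) (i : 'I_m.+1) (x : 'rV[R]_n)
    (t : 'I_(kdim K).-1 -> R) (X Y Z : 'rV[R]_n) : R :=
  let h := fs_metric kappa i in
  let f := local_rep c i in
  let JJperp v := normal_part h f x (acs_span t (dmx f x v)) in
  bform (induced_metric c i x)
    (shape h f x (JJperp X) Y - shape h f x (JJperp Y) X) Z.

End Maps.

(* Main.v *)
(* Idea. Encode a line [sigma] of K^N by the real matrix [P] of the orthogonal
   projection onto it.  On lines the tangent space is the space of derivatives
   of [P], the metric is a multiple of [tr (P_u P_v)], and, by Koszul's formula,
   the Levi-Civita connection of any metric of the form [tr (P_u P_v)] satisfies
   [<Gamma(c, u), v> = tr (P_cu P_v)].  The pulled-back universal connection is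
   [W |-> (dW) P]; by the symmetry of second derivatives its curvature is the
   commutator [P_v, P_u] restricted to the line.  Differentiating, only the
   off-diagonal block of [P_cu] with respect to [P] matters, which is the
   derivative of [P] in the direction of the ambient covariant derivative;
   after subtracting [Gamma] only the second fundamental form remains:
   (D_c R)(u, v) = R(II(c, u), v) + R(u, II(c, v)).
   On a generator [w] of the line, the component of [R(u, v) w] along [w J] is
   a nonzero multiple of [<J u, v>] for each imaginary unit [J], whence
   the component of (D_c R)(u, v) is a nonzero multiple of
   [<II(c, v), J u> - <II(c, u), J v>], the form in the theorem. *)
Require Import Defs.
From mathcomp Require Import all_boot all_order all_algebra.
From mathcomp Require Import all_classical all_reals all_analysis.
From mathcomp Require Import ring lra.

Import Order.TTheory GRing.Theory Num.Theory.
Import numFieldNormedType.Exports.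

Local Open Scope classical_set_scope.
Local Open Scope ring_scope.

Set Implicit Arguments.
Unset Strict Implicit.
Unset Printing Implicit Defensive.

(** * Differential calculus in coordinates *)

(** A line determines its projector, whereas a generator is defined only up to a scalar function;
    with projectors no change of generator has to be followed. They also make the ambient and the
    induced metric two cases of [trace_metric], for [chart_proj] and for its composite with the
    immersion, so that one computation of Christoffel symbols serves both. The obstacle is that a
    second derivative of a projector is not [tangent]: differentiating [P P = P] twice creates
    diagonal blocks. A tangent matrix exchanges the line and its orthogonal complement, so these
    blocks vanish from traces against it and from products with it compressed to the line. All
    matrices commute with the right action of the scalars, which reduces identities on the line to a
    single generator. A tangent matrix has two transposed off-diagonal blocks and a line has real
    dimension [d]; the trace form is therefore [2 d] times the metric of Hom(sigma, sigma^perp),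
    whence the factor [kappa / (2 d)]. Projections and shape operators are given by a choice
    operator; definiteness of the metrics identifies the chosen values. *)

Section Differentiability.
Context {R : realType} {V W : normedModType R}.

(** The first order expansion of [f] at [x] is also one for [g], and [diff_unique] recognizes its
    linear part as the differential of [g]. *)
Lemma near_eq_differentiable (f g : V -> W) (x : V) :
  (\forall y \near x, f y = g y) -> differentiable f x -> differentiable g x.
Proof.
move=> fg df.
have dc : continuous ('d f x) by exact: diff_continuous.
have E : g \o shift x = cst (g x) + 'd f x +o_ (0 : V) id.
  apply/eqaddoP => _/posnumP[e].
  have /eqaddoP/(_ e%:num (ltac:(done))) := diff_locally df.
  have gx : g x = f x by have /nbhs_singleton := fg.
  have fg0 : \forall y \near (0 : V), f (y + x) = g (y + x).
    by move: fg; rewrite (near_shift 0); apply: filterS => y /=; rewrite subr0.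
  apply: filter_app; move: fg0; apply: filterS => y /= e1 h.
  by move: h; rewrite /= !fctE /= -!e1 gx.
apply/diff_locallyP; rewrite (diff_unique dc E); split => //.
Qed.

Lemma derive_dirE (f : V -> W) (x v : V) : differentiable f x ->
  forall a (u : V), 'D_(a *: u + v) f x = a *: 'D_u f x + 'D_v f x.
Proof. by move=> df a u; rewrite !deriveE// linearP. Qed.

Lemma is_derive_line (f : V -> W) (y u : V) (s : R) :
  differentiable f (s *: u + y) ->
  is_derive s 1 (fun s => f (s *: u + y)) ('D_u f (s *: u + y)).
Proof.
move=> df.
have H : is_diff s (fun s : R => s *: u + y) (fun s => s *: u).
  have H := is_diffD (is_diff_scalel s u) (is_diff_cst (V := R) y s).
  by apply: (is_diff_eq H); rewrite addr0.
have dg : differentiable (fun s : R => s *: u + y) s by apply: ex_diff.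
have dfg : differentiable (f \o (fun s : R => s *: u + y)) s.
  exact: differentiable_comp.
apply: DeriveDef; first by apply/derivable1_diffP.
by rewrite deriveE// diff_comp// deriveE//= diff_val /= scale1r.
Qed.

End Differentiability.

(** * Closure properties of C^k functions *)

Section CkClosure.
Context {R : realType} {n : nat}.
Implicit Types (U : set 'rV[R]_n) (f g : 'rV[R]_n -> R) (k : nat).

Lemma Ck_sub k U U' f : U' `<=` U -> Ck k U f -> Ck k U' f.
Proof.
by elim: k f => [|k IH] f s /=; [move=> c x /s/c|move=> [d c]; split => [x /s/d|v]//; apply: IH].
Qed.

Lemma Ck_eq k U f g : open U -> (forall x, U x -> f x = g x) ->
  Ck k U f -> Ck k U g.
Proof.
move=> oU; elim: k f g => [|k IH] f g fg /=.
  move=> c x Ux; have fgx : \forall y \near x, f y = g y.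
    by apply: filterS (open_nbhs_nbhs (conj oU Ux)) => y /fg.
  rewrite /prop_for /continuous_at -(fg _ Ux).
  exact: cvg_trans (near_eq_cvg fgx) (c x Ux).
move=> [d c]; split => [x Ux|v].
  apply: near_eq_differentiable (d x Ux).
  by apply: filterS (open_nbhs_nbhs (conj oU Ux)) => y /fg.
apply: IH (c v) => x Ux; apply: near_eq_derive.
by apply: filterS (open_nbhs_nbhs (conj oU Ux)) => y /fg.
Qed.

Lemma Ck_ext k U f g : f =1 g -> Ck k U f -> Ck k U g.
Proof. by move=> /funext ->. Qed.

Lemma CkW k U f : Ck k.+1 U f -> Ck k U f.
Proof.
elim: k f => [|k IH] f [d c]; first by move=> x /d/differentiable_continuous.
by split => // v; apply: IH; exact: c.
Qed.

Lemma Ck_cst k U (c : R) : Ck k U (fun=> c).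
Proof.
elim: k c => [|k IH] c; first by move=> x _; exact: cst_continuous.
split => [x _|v]; first exact: differentiable_cst.
by apply: Ck_ext (IH 0) => x; rewrite derive_cst.
Qed.

Lemma CkD k U f g : open U -> Ck k U f -> Ck k U g ->
  Ck k U (fun x => f x + g x).
Proof.
move=> oU; elim: k f g => [|k IH] f g.
  by move=> cf cg x Ux; apply: continuousD; [exact: cf|exact: cg].
move=> [df cf] [dg cg]; split => [x Ux|v].
  exact: differentiableD (df _ Ux) (dg _ Ux).
apply: Ck_eq (IH _ _ (cf v) (cg v)) => // x Ux.
by rewrite (deriveD (diff_derivable (df _ Ux)) (diff_derivable (dg _ Ux))).
Qed.

Lemma CkM k U f g : open U -> Ck k U f -> Ck k U g ->
  Ck k U (fun x => f x * g x).
Proof.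
move=> oU; elim: k f g => [|k IH] f g.
  by move=> cf cg x Ux; apply: continuousM; [exact: cf|exact: cg].
move=> sf sg; have [df cf] := sf; have [dg cg] := sg; split => [x Ux|v].
  exact: differentiableM (df _ Ux) (dg _ Ux).
have := CkD oU (IH _ _ (CkW sf) (cg v)) (IH _ _ (CkW sg) (cf v)).
apply: Ck_eq => // x Ux.
by rewrite (deriveM (diff_derivable (df _ Ux)) (diff_derivable (dg _ Ux))).
Qed.

Lemma Ck_sum k U (I : Type) (r : seq I) (P : pred I)
    (F : I -> 'rV[R]_n -> R) : open U -> (forall i, P i -> Ck k U (F i)) ->
  Ck k U (fun x => \sum_(i <- r | P i) F i x).
Proof.
move=> oU h; elim: r => [|i r IH].
  by apply: Ck_ext (Ck_cst k U 0) => x; rewrite big_nil.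
case Pi: (P i).
  by apply: Ck_ext (CkD oU (h _ Pi) IH) => x; rewrite big_cons Pi.
by apply: Ck_ext IH => x; rewrite big_cons Pi.
Qed.

(** By induction on [k]: the derivative [- f^-2 D f] involves the inverse only at the previous
    order. *)
Lemma CkV k U f : open U -> (forall x, U x -> f x != 0) -> Ck k U f ->
  Ck k U (fun x => (f x)^-1).
Proof.
move=> oU f0; elim: k => [|k IH].
  by move=> cf x Ux; exact: (cvgV (f0 x Ux) (cf x Ux)).
move=> sf; have [df cf] := sf; split => [x Ux|v].
  exact: differentiableV (df _ Ux) (f0 _ Ux).
have IH' := IH (CkW sf).
have := CkM oU (Ck_cst k U (-1)) (CkM oU (CkM oU IH' IH') (cf v)).
apply: Ck_eq => // x Ux.
rewrite (deriveV (f0 _ Ux) (diff_derivable (df _ Ux))).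
by rewrite /GRing.scale /= mulN1r mulNr -exprVn expr2.
Qed.

Lemma Ck_coord k U (i : 'I_1) (j : 'I_n) : Ck k U (fun x => x i j).
Proof.
case: k => [|k]; first by move=> x _; exact: coord_continuous.
split => [x _|v]; first exact: differentiable_coord.
apply: Ck_ext (Ck_cst k U (v i j)) => x.
by have := derive_mx (@derivable_id _ _ x v); rewrite derive_id => /matrixP/(_ i j); rewrite mxE => <-.
Qed.

End CkClosure.

(** * Symmetry of second derivatives *)

Section Schwarz.
Context {R : realType} {n : nat}.
Implicit Types (U : set 'rV[R]_n) (f : 'rV[R]_n -> R).

(** Two mean value theorems: along [u] for the difference of [f] on two opposite sides of the
    parallelogram, then along [v] for [D_u f]. *)
Lemma second_difference_MVT U f (x u v : 'rV[R]_n) (t : R) : Ck 2 U f -> 0 < t ->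
  (forall a b, 0 <= a <= t -> 0 <= b <= t -> U (x + a *: u + b *: v)) ->
  exists a b, [/\ 0 <= a <= t, 0 <= b <= t &
    f (x + t *: u + t *: v) - f (x + t *: u) - f (x + t *: v) + f x =
    t ^+ 2 * 'D_v (fun y => 'D_u f y) (x + a *: u + b *: v)].
Proof.
move=> [df cf] t0 hU.
have line (g : 'rV[R]_n -> R) y w s : differentiable g (y + s *: w) ->
    is_derive s 1 (fun s => g (y + s *: w)) ('D_w g (y + s *: w)).
  move=> dg; rewrite addrC in dg *.
  have -> : (fun s => g (y + s *: w)) = (fun s => g (s *: w + y)).
    by apply/funext => s'; rewrite addrC.
  exact: is_derive_line.
have itv s : s \in `]0, t[ -> 0 <= s <= t.
  by rewrite in_itv/= => /andP[? ?]; rewrite !ltW.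
pose phi s := f (x + t *: v + s *: u) - f (x + s *: u).
pose dphi s := 'D_u f (x + t *: v + s *: u) - 'D_u f (x + s *: u).
have dphiP s : 0 <= s <= t -> is_derive s 1 phi (dphi s).
  move=> st; apply: is_deriveB; apply: line; apply: df.
    by rewrite addrAC; apply: hU => //; rewrite lexx ltW.
  by have := hU s 0 st; rewrite scale0r addr0; apply; rewrite lexx ltW.
have cphi : {within `[0, t], continuous phi}.
  apply: derivable_within_continuous => s; rewrite in_itv/= => /dphiP.
  by move=> h; exact: ex_derive.
have [a + Ea] := MVT t0 (fun s st => dphiP s (itv s st)) cphi.
rewrite in_itv/= => /andP[a0 at_].
have sa : 0 <= a <= t by rewrite !ltW.
pose psi s := 'D_u f (x + a *: u + s *: v).
pose dpsi s := 'D_v (fun y => 'D_u f y) (x + a *: u + s *: v).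
have dpsiP s : 0 <= s <= t -> is_derive s 1 psi (dpsi s).
  move=> st; apply: (line (fun y => 'D_u f y)).
  by have [+ _] := cf u; apply; exact: hU.
have cpsi : {within `[0, t], continuous psi}.
  apply: derivable_within_continuous => s; rewrite in_itv/= => /dpsiP.
  by move=> h; exact: ex_derive.
have [b + Eb] := MVT t0 (fun s st => dpsiP s (itv s st)) cpsi.
rewrite in_itv/= => /andP[b0 bt].
have sb : 0 <= b <= t by rewrite !ltW.
exists a, b; split => //.
have : phi t - phi 0 = t ^+ 2 * dpsi b.
  rewrite Ea; have -> : dphi a = psi t - psi 0.
    by rewrite /dphi /psi scale0r addr0 addrAC.
  by rewrite Eb subr0 expr2; ring.
rewrite /phi !scale0r !addr0 => <-.
rewrite [x + t *: v + t *: u]addrAC; ring.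
Qed.

(** The second difference is symmetric in [u] and [v], so the two mixed derivatives take a common
    value at two points arbitrarily close to [x]; continuity concludes. *)
Lemma derive_comm U f (x u v : 'rV[R]_n) : open U -> U x -> Ck 2 U f ->
  'D_u (fun y => 'D_v f y) x = 'D_v (fun y => 'D_u f y) x.
Proof.
move=> oU Ux cf.
have c2 w w' : {for x, continuous (fun y => 'D_w (fun y => 'D_w' f y) y)}.
  by have [_ /(_ w') [_ /(_ w)]] := cf; apply.
apply/eqP; rewrite -subr_eq0 -normr_le0; apply/ler_addgt0Pr => _/posnumP[e].
have e2 : 0 < e%:num / 2 by [].
have := c2 u v => /cvgrPdist_lt/(_ _ e2) near1.
have := c2 v u => /cvgrPdist_lt/(_ _ e2) near2.
have nearU := open_nbhs_nbhs (conj oU Ux).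
have [r /= r0 hr] := (nbhs_ballP _ _).1 (filterI nearU (filterI near1 near2)).
(* This size keeps both parallelograms inside the ball of radius [r]; the summand 1 keeps the
   divisor positive when [u] and [v] vanish. *)
pose t := r / (2 * (`|u| + `|v| + 1)).
have M0 : 0 < `|u| + `|v| + 1 by rewrite ltr_wpDl// addr_ge0.
have t0 : 0 < t by rewrite divr_gt0// mulr_gt0.
have inb a b w w' : `|w| + `|w'| = `|u| + `|v| -> 0 <= a <= t -> 0 <= b <= t ->
    ball x r (x + a *: w + b *: w').
  move=> ww /andP[a0 a1] /andP[b0 b1].
  rewrite -ball_normE /= -addrA opprD addNKr normrN.
  apply: (le_lt_trans (ler_normD _ _)); rewrite !normrZ !ger0_norm//.
  apply: (@le_lt_trans _ _ (t * (`|u| + `|v|))).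
    by rewrite -ww mulrDr lerD// ler_wpM2r.
  rewrite /t mulrAC ltr_pdivrMr ?mulr_gt0// ltr_pM2l//.
  have : 0 <= `|u| + `|v| by rewrite addr_ge0.
  by move=> ?; lra.
have uv : `|u| + `|v| = `|u| + `|v| by [].
have vu : `|v| + `|u| = `|u| + `|v| by rewrite addrC.
have [a [b [ha hb E1]]] := second_difference_MVT cf t0
  (fun a b ha hb => (hr _ (inb a b u v uv ha hb)).1).
have [a' [b' [ha' hb' E2]]] := second_difference_MVT cf t0
  (fun a b ha hb => (hr _ (inb a b v u vu ha hb)).1).
have [_ [_ h1]] := hr _ (inb _ _ _ _ uv ha hb).
have [_ [h2 _]] := hr _ (inb _ _ _ _ vu ha' hb').
move: E1 E2 h1 h2 => /=.
set D1 := derive _ (_ + b *: v) _; set D2 := derive _ (_ + b' *: u) _.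
rewrite [x + t *: v + t *: u]addrAC (addrAC (f _) (- f (x + t *: u))).
move: D1 D2 (derive _ x u) (derive _ x v) => D1 D2 d1 d2 -> /mulfI.
rewrite expf_neq0 ?gt_eqF// => /(_ isT) <- h1 h2.
rewrite add0r; apply: (le_trans (ler_distD D1 _ _)).
by rewrite [leRHS](splitr e%:num) lerD// ltW// distrC.
Qed.

End Schwarz.

(** * Derivatives of matrix-valued functions *)

Section MatrixDerivative.
Context {R : realType} {n : nat}.
Implicit Types (x u v : 'rV[R]_n).

Definition mdiff {p q} (F : 'rV[R]_n -> 'M[R]_(p, q)) x :=
  forall a b, differentiable (fun y => F y a b) x.

Lemma near_eq_mdiff p q (F G : 'rV[R]_n -> 'M[R]_(p, q)) x :
  (\forall y \near x, F y = G y) -> mdiff F x -> mdiff G x.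
Proof.
move=> FG dF a b; apply: near_eq_differentiable (dF a b).
by apply: filterS FG => y ->.
Qed.

Lemma near_eq_dmx p q (F G : 'rV[R]_n -> 'M[R]_(p, q)) x v :
  (\forall y \near x, F y = G y) -> dmx F x v = dmx G x v.
Proof.
move=> FG; apply/matrixP => a b; rewrite !mxE; apply: near_eq_derive.
by apply: filterS FG => y ->.
Qed.

Lemma eq_dmx p q (F G : 'rV[R]_n -> 'M[R]_(p, q)) x v :
  F =1 G -> dmx F x v = dmx G x v.
Proof. by move=> /funext ->. Qed.

Lemma dmxP p q (F : 'rV[R]_n -> 'M[R]_(p, q)) x a u v : mdiff F x ->
  dmx F x (a *: u + v) = a *: dmx F x u + dmx F x v.
Proof.
by move=> dF; apply/matrixP => i j; rewrite !mxE derive_dirE//; exact: dF.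
Qed.

Lemma dmx0v p q (F : 'rV[R]_n -> 'M[R]_(p, q)) x : dmx F x 0 = 0.
Proof. by apply/matrixP => i j; rewrite !mxE derive0. Qed.

Lemma dmxZv p q (F : 'rV[R]_n -> 'M[R]_(p, q)) x a u : mdiff F x ->
  dmx F x (a *: u) = a *: dmx F x u.
Proof. by move=> /(dmxP a u 0); rewrite dmx0v !addr0. Qed.

Lemma dmxDv p q (F : 'rV[R]_n -> 'M[R]_(p, q)) x u v : mdiff F x ->
  dmx F x (u + v) = dmx F x u + dmx F x v.
Proof. by move=> /(dmxP 1 u v); rewrite !scale1r. Qed.

Lemma dmxBv p q (F : 'rV[R]_n -> 'M[R]_(p, q)) x u v : mdiff F x ->
  dmx F x (u - v) = dmx F x u - dmx F x v.
Proof. by move=> dF; rewrite dmxDv// -scaleN1r dmxZv// scaleN1r. Qed.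

Lemma dmx_sumv p q (F : 'rV[R]_n -> 'M[R]_(p, q)) x (I : Type) (r : seq I)
    (v : I -> 'rV[R]_n) : mdiff F x ->
  dmx F x (\sum_(i <- r) v i) = \sum_(i <- r) dmx F x (v i).
Proof.
move=> dF; elim: r => [|i r IH]; first by rewrite !big_nil dmx0v.
by rewrite !big_cons dmxDv// IH.
Qed.

Lemma dmx_sum_delta p q (F : 'rV[R]_n -> 'M[R]_(p, q)) x v : mdiff F x ->
  dmx F x v = \sum_j v 0 j *: dmx F x (delta_mx 0 j).
Proof.
move=> dF; rewrite {1}(row_sum_delta v) dmx_sumv//.
by apply: eq_bigr => j _; rewrite dmxZv.
Qed.

Lemma mdiff_cst p q (A : 'M[R]_(p, q)) x : mdiff (fun=> A) x.
Proof. by move=> a b; exact: differentiable_cst. Qed.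

Lemma dmx_cst p q (A : 'M[R]_(p, q)) x v : dmx (fun=> A) x v = 0.
Proof. by apply/matrixP => a b; rewrite !mxE derive_cst. Qed.

Lemma mdiffD p q (F G : 'rV[R]_n -> 'M[R]_(p, q)) x : mdiff F x -> mdiff G x ->
  mdiff (fun y => F y + G y) x.
Proof.
move=> dF dG a b.
rewrite (_ : (fun y => _) = (fun y => F y a b) + (fun y => G y a b)).
  exact: differentiableD.
by apply/funext => y; rewrite mxE.
Qed.

Lemma dmxD p q (F G : 'rV[R]_n -> 'M[R]_(p, q)) x v : mdiff F x -> mdiff G x ->
  dmx (fun y => F y + G y) x v = dmx F x v + dmx G x v.
Proof.
move=> dF dG; apply/matrixP => a b; rewrite !mxE.
have -> : (fun y => (F y + G y) a b) = (fun y => F y a b) + (fun y => G y a b).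
  by apply/funext => y; rewrite mxE.
by rewrite (deriveD (diff_derivable (dF a b)) (diff_derivable (dG a b))).
Qed.

Lemma differentiable_bigsum (I : Type) (r : seq I) (f : I -> 'rV[R]_n -> R) x :
  (forall i, differentiable (f i) x) ->
  differentiable (fun y => \sum_(i <- r) f i y) x.
Proof.
move=> df; elim: r => [|i r IH].
  rewrite (_ : (fun y => _) = cst 0); first exact: differentiable_cst.
  by apply/funext => y; rewrite big_nil.
rewrite (_ : (fun y => _) = f i + (fun y => \sum_(i <- r) f i y)).
  exact: differentiableD.
by apply/funext => y; rewrite big_cons.
Qed.

Lemma derive_bigsum (I : Type) (r : seq I) (f : I -> 'rV[R]_n -> R) x v :
  (forall i, differentiable (f i) x) ->
  'D_v (fun y => \sum_(i <- r) f i y) x = \sum_(i <- r) 'D_v (f i) x.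
Proof.
move=> df; elim: r => [|i r IH].
  rewrite big_nil (_ : (fun y => _) = cst 0); first exact: derive_cst.
  by apply/funext => y; rewrite big_nil.
rewrite big_cons -IH.
have -> : (fun y => \sum_(j <- i :: r) f j y) =
    f i + (fun y => \sum_(i <- r) f i y).
  by apply/funext => y; rewrite big_cons.
by rewrite (deriveD (diff_derivable (df i))
  (diff_derivable (differentiable_bigsum r df))).
Qed.

Lemma mdiffM p q r (F : 'rV[R]_n -> 'M[R]_(p, q))
    (G : 'rV[R]_n -> 'M[R]_(q, r)) x : mdiff F x -> mdiff G x ->
  mdiff (fun y => F y *m G y) x.
Proof.
move=> dF dG a b.
rewrite (_ : (fun y => _) = fun y => \sum_j F y a j * G y j b).
  by apply: differentiable_bigsum => j; exact: differentiableM.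
by apply/funext => y; rewrite mxE.
Qed.

Lemma dmxM p q r (F : 'rV[R]_n -> 'M[R]_(p, q))
    (G : 'rV[R]_n -> 'M[R]_(q, r)) x v : mdiff F x -> mdiff G x ->
  dmx (fun y => F y *m G y) x v = dmx F x v *m G x + F x *m dmx G x v.
Proof.
move=> dF dG; apply/matrixP => a b; rewrite !mxE -big_split/=.
rewrite (_ : (fun y => _) = fun y => \sum_j F y a j * G y j b); last first.
  by apply/funext => y; rewrite mxE.
rewrite derive_bigsum => [|j]; last exact: differentiableM.
apply: eq_bigr => j _; rewrite !mxE.
rewrite (deriveM (diff_derivable (dF a j)) (diff_derivable (dG j b))).
by rewrite addrC; congr (_ + _); exact: mulrC.
Qed.

(** Each entry of [L (F y)] is a combination of entries of [F y] with constant coefficients. This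
    treats transposition, [mxvec], [vec_mx] and products with a constant matrix at once. *)
Lemma mdiff_lin p q p' q' (L : {linear 'M[R]_(p, q) -> 'M[R]_(p', q')})
    (F : 'rV[R]_n -> 'M[R]_(p, q)) x : mdiff F x -> mdiff (fun y => L (F y)) x.
Proof.
move=> dF a b.
rewrite (_ : (fun y => _) =
  fun y => \sum_i \sum_j F y i j * L (delta_mx i j) a b).
  apply: differentiable_bigsum => i; apply: differentiable_bigsum => j.
  by apply: differentiableM => //; exact: differentiable_cst.
apply/funext => y; rewrite {1}(matrix_sum_delta (F y)) linear_sum summxE.
apply: eq_bigr => i _; rewrite linear_sum summxE.
by apply: eq_bigr => j _; rewrite linearZ mxE.
Qed.

Lemma dmx_lin p q p' q' (L : {linear 'M[R]_(p, q) -> 'M[R]_(p', q')})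
    (F : 'rV[R]_n -> 'M[R]_(p, q)) x v : mdiff F x ->
  dmx (fun y => L (F y)) x v = L (dmx F x v).
Proof.
move=> dF; apply/matrixP => a b; rewrite mxE.
rewrite (_ : (fun y => _) =
  fun y => \sum_i \sum_j F y i j * L (delta_mx i j) a b); last first.
  apply/funext => y; rewrite {1}(matrix_sum_delta (F y)) linear_sum summxE.
  apply: eq_bigr => i _; rewrite linear_sum summxE.
  by apply: eq_bigr => j _; rewrite linearZ mxE.
rewrite (matrix_sum_delta (dmx F x v)) linear_sum summxE.
have d i j : differentiable (fun y => F y i j * L (delta_mx i j) a b) x.
  by apply: differentiableM => //; exact: differentiable_cst.
rewrite derive_bigsum => [|i]; last exact: differentiable_bigsum.
apply: eq_bigr => i _; rewrite linear_sum summxE derive_bigsum//.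
apply: eq_bigr => j _; rewrite linearZ !mxE.
rewrite (deriveM (diff_derivable (dF i j)) (derivable_cst _ _ _)).
by rewrite derive_cst scaler0 add0r; exact: mulrC.
Qed.

Lemma mdiffB p q (F G : 'rV[R]_n -> 'M[R]_(p, q)) x : mdiff F x -> mdiff G x ->
  mdiff (fun y => F y - G y) x.
Proof. by move=> dF dG; exact: mdiffD dF (mdiff_lin -%R dG). Qed.

Lemma dmxB p q (F G : 'rV[R]_n -> 'M[R]_(p, q)) x v : mdiff F x -> mdiff G x ->
  dmx (fun y => F y - G y) x v = dmx F x v - dmx G x v.
Proof.
by move=> dF dG; rewrite (dmxD _ dF (mdiff_lin -%R dG)) (dmx_lin -%R).
Qed.

End MatrixDerivative.

Section ChainRule.
Context {R : realType} {n q : nat}.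
Variables (f : 'rV[R]_n -> 'rV[R]_q) (x : 'rV[R]_n).
Hypothesis df : mdiff f x.

(** The chain rule requires a differential of the whole map; it is recovered from the entries by
    summing along the standard basis. *)
Lemma mdiff_differentiable : differentiable f x.
Proof.
have -> : f = \sum_j (fun y => f y 0 j *: (delta_mx 0 j : 'rV[R]_q)).
  by apply/funext => y; rewrite fct_sumE -row_sum_delta.
by apply: differentiable_sum => j; apply: differentiableZl; exact: df.
Qed.

Lemma derive_row v : 'D_v f x = dmx f x v.
Proof. by rewrite derive_mx//; exact/diff_derivable/mdiff_differentiable. Qed.

Lemma differentiable_comp_mdiff (g : 'rV[R]_q -> R) :
  differentiable g (f x) -> differentiable (fun y => g (f y)) x.
Proof. move=> dg; apply: differentiable_comp => //; exact: mdiff_differentiable. Qed.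

Lemma derive_comp_mdiff (g : 'rV[R]_q -> R) v : differentiable g (f x) ->
  'D_v (fun y => g (f y)) x = 'D_(dmx f x v) g (f x).
Proof.
move=> dg; rewrite -derive_row.
have dfx := mdiff_differentiable.
rewrite deriveE; last exact: differentiable_comp.
by rewrite diff_comp//= !deriveE.
Qed.

Lemma dmx_comp p r (G : 'rV[R]_q -> 'M[R]_(p, r)) v : mdiff G (f x) ->
  dmx (fun y => G (f y)) x v = dmx G (f x) (dmx f x v).
Proof.
move=> dG; apply/matrixP => a b; rewrite !mxE.
exact: (derive_comp_mdiff (g := fun z => G z a b)).
Qed.

End ChainRule.

(** * Smooth matrix fields and iterated derivatives *)

Section SmoothFields.
Context {R : realType} {n : nat}.
Implicit Types (x u v : 'rV[R]_n) (U : set 'rV[R]_n).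

Lemma smooth_on_sub p q U U' (F : 'rV[R]_n -> 'M[R]_(p, q)) :
  U' `<=` U -> smooth_on U F -> smooth_on U' F.
Proof. by move=> s sF a b k; exact: Ck_sub (sF a b k). Qed.

Lemma smooth_on_mdiff p q U (F : 'rV[R]_n -> 'M[R]_(p, q)) x :
  U x -> smooth_on U F -> mdiff F x.
Proof. by move=> Ux sF a b; have [d _] := sF a b 1%N; exact: d. Qed.

Lemma smooth_onM p q r U (F : 'rV[R]_n -> 'M[R]_(p, q))
    (G : 'rV[R]_n -> 'M[R]_(q, r)) :
  open U -> smooth_on U F -> smooth_on U G -> smooth_on U (fun y => F y *m G y).
Proof.
move=> oU sF sG a b k.
apply: (Ck_ext (f := fun y => \sum_j F y a j * G y j b)).
  by move=> y; rewrite mxE.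
by apply: Ck_sum => // j _; apply: CkM.
Qed.

Lemma smooth_onD p q U (F G : 'rV[R]_n -> 'M[R]_(p, q)) :
  open U -> smooth_on U F -> smooth_on U G -> smooth_on U (fun y => F y + G y).
Proof.
move=> oU sF sG a b k.
by apply: (Ck_ext _ (CkD oU (sF a b k) (sG a b k))) => y; rewrite mxE.
Qed.

Lemma smooth_on_cst p q U (A : 'M[R]_(p, q)) : smooth_on U (fun=> A).
Proof. by move=> a b k; exact: Ck_cst. Qed.

Lemma smooth_on_lin p q p' q' U
    (L : {linear 'M[R]_(p, q) -> 'M[R]_(p', q')})
    (F : 'rV[R]_n -> 'M[R]_(p, q)) :
  open U -> smooth_on U F -> smooth_on U (fun y => L (F y)).
Proof.
move=> oU sF a b k.
apply: (Ck_ext (f := fun y => \sum_i \sum_j F y i j * L (delta_mx i j) a b)).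
  move=> y; rewrite {2}(matrix_sum_delta (F y)) linear_sum summxE.
  apply: eq_bigr => i _; rewrite linear_sum summxE.
  by apply: eq_bigr => j _; rewrite linearZ mxE.
apply: Ck_sum => // i _; apply: Ck_sum => // j _; apply: CkM => //.
exact: Ck_cst.
Qed.

Lemma smooth_on_dmx p q U (F : 'rV[R]_n -> 'M[R]_(p, q)) v :
  smooth_on U F -> smooth_on U (fun y => dmx F y v).
Proof.
move=> sF a b k; have [_ /(_ v)] := sF a b k.+1.
by apply: Ck_ext => y; rewrite mxE.
Qed.

(** [Ck] only speaks of fixed directions; a variable direction is expanded in coordinates, which
    writes the function as a sum of products. *)
Lemma smooth_on_dmx_field p q U (F : 'rV[R]_n -> 'M[R]_(p, q))
    (X : 'rV[R]_n -> 'rV[R]_n) : open U ->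
  smooth_on U F -> smooth_on U X -> smooth_on U (fun y => dmx F y (X y)).
Proof.
move=> oU sF sX a b k.
apply: (Ck_eq (f := fun y => \sum_j X y 0 j * dmx F y (delta_mx 0 j) a b)) => //.
  move=> y Uy; rewrite [in RHS](dmx_sum_delta _ (smooth_on_mdiff Uy sF)).
  by rewrite summxE; apply: eq_bigr => j _; rewrite [in RHS]mxE.
apply: Ck_sum => // j _; apply: CkM => //.
exact: smooth_on_dmx sF a b k.
Qed.

Lemma smooth_near_mdiff p q (F : 'rV[R]_n -> 'M[R]_(p, q)) x :
  smooth_near x F -> mdiff F x.
Proof. by move=> [U [oU Ux sF]]; exact: smooth_on_mdiff sF. Qed.

Lemma smooth_near_nbhs p q (F : 'rV[R]_n -> 'M[R]_(p, q)) x :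
  smooth_near x F -> \forall y \near x, smooth_near y F.
Proof.
move=> [U [oU Ux sF]].
by apply: filterS (open_nbhs_nbhs (conj oU Ux)) => y Uy; exists U.
Qed.

Lemma smooth_near_eq p q (F G : 'rV[R]_n -> 'M[R]_(p, q)) x :
  (\forall y \near x, F y = G y) -> smooth_near x F -> smooth_near x G.
Proof.
move=> FG [U [oU Ux sF]]; pose V := [set y | F y = G y]^°.
have oUV : open (U `&` V) by apply: openI => //; exact: open_interior.
exists (U `&` V); split => // a b k.
apply: (Ck_eq (f := fun y => F y a b)) => //.
  by move=> y [_ /interior_subset/= ->].
exact: smooth_on_sub (@subIsetl _ _ _) sF a b k.
Qed.

Lemma smooth_near2 p q p' q' (F : 'rV[R]_n -> 'M[R]_(p, q))
    (G : 'rV[R]_n -> 'M[R]_(p', q')) x : smooth_near x F -> smooth_near x G ->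
  exists U, [/\ open U, U x, smooth_on U F & smooth_on U G].
Proof.
move=> [U [oU Ux sF]] [V [oV Vx sG]]; exists (U `&` V).
split; [exact: openI|by split|exact: smooth_on_sub sF|exact: smooth_on_sub sG].
Qed.

Lemma smooth_nearM p q r (F : 'rV[R]_n -> 'M[R]_(p, q))
    (G : 'rV[R]_n -> 'M[R]_(q, r)) x :
  smooth_near x F -> smooth_near x G -> smooth_near x (fun y => F y *m G y).
Proof.
move=> sF sG; have [U [oU Ux UF UG]] := smooth_near2 sF sG.
by exists U; split => //; exact: smooth_onM.
Qed.

Lemma smooth_nearD p q (F G : 'rV[R]_n -> 'M[R]_(p, q)) x :
  smooth_near x F -> smooth_near x G -> smooth_near x (fun y => F y + G y).
Proof.
move=> sF sG; have [U [oU Ux UF UG]] := smooth_near2 sF sG.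
by exists U; split => //; exact: smooth_onD.
Qed.

Lemma smooth_near_cst p q (A : 'M[R]_(p, q)) x : smooth_near x (fun=> A).
Proof. by exists setT; split => //; [exact: openT|exact: smooth_on_cst]. Qed.

Lemma smooth_near_lin p q p' q' (L : {linear 'M[R]_(p, q) -> 'M[R]_(p', q')})
    (F : 'rV[R]_n -> 'M[R]_(p, q)) x :
  smooth_near x F -> smooth_near x (fun y => L (F y)).
Proof.
by move=> [U [oU Ux sF]]; exists U; split => //; exact: smooth_on_lin.
Qed.

Lemma smooth_near_dmx p q (F : 'rV[R]_n -> 'M[R]_(p, q)) x v :
  smooth_near x F -> smooth_near x (fun y => dmx F y v).
Proof.
by move=> [U [oU Ux sF]]; exists U; split => //; exact: smooth_on_dmx.
Qed.

Lemma smooth_near_dmx_field p q (F : 'rV[R]_n -> 'M[R]_(p, q))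
    (X : 'rV[R]_n -> 'rV[R]_n) x :
  smooth_near x F -> smooth_near x X ->
  smooth_near x (fun y => dmx F y (X y)).
Proof.
move=> sF sX; have [U [oU Ux UF UX]] := smooth_near2 sF sX.
by exists U; split => //; exact: smooth_on_dmx_field.
Qed.

Lemma dmx_comm p q (F : 'rV[R]_n -> 'M[R]_(p, q)) x u v : smooth_near x F ->
  dmx (fun y => dmx F y v) x u = dmx (fun y => dmx F y u) x v.
Proof.
move=> [U [oU Ux sF]]; apply/matrixP => a b; rewrite [LHS]mxE [RHS]mxE.
have E w : (fun y => dmx F y w a b) = fun y => 'D_w (fun z => F z a b) y.
  by apply/funext => y; rewrite mxE.
rewrite (E v) (E u); exact: (derive_comm _ _ oU Ux (sF a b 2%N)).
Qed.

Lemma dmx_field_sum p q (F : 'rV[R]_n -> 'M[R]_(p, q))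
    (X : 'rV[R]_n -> 'rV[R]_n) x a b : smooth_near x F ->
  \forall y \near x, dmx F y (X y) a b =
    \sum_j X y 0 j * dmx F y (delta_mx 0 j) a b.
Proof.
move=> /smooth_near_nbhs; apply: filterS => y /smooth_near_mdiff dF.
by rewrite dmx_sum_delta// summxE; apply: eq_bigr => j _; rewrite [in LHS]mxE.
Qed.

Lemma mdiff_dmx_field p q (F : 'rV[R]_n -> 'M[R]_(p, q))
    (X : 'rV[R]_n -> 'rV[R]_n) x : smooth_near x F -> mdiff X x ->
  mdiff (fun y => dmx F y (X y)) x.
Proof.
move=> sF dX a b.
have E : \forall y \near x, \sum_j X y 0 j * dmx F y (delta_mx 0 j) a b =
    dmx F y (X y) a b.
  by apply: filterS (dmx_field_sum X a b sF) => y.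
apply: near_eq_differentiable E _.
apply: differentiable_bigsum => j; apply: differentiableM => //.
exact: smooth_near_mdiff (smooth_near_dmx _ sF) a b.
Qed.

End SmoothFields.

Lemma dmx_id (R : realType) (n : nat) (x u : 'rV[R]_n) : dmx id x u = u.
Proof.
apply/rowP => j; rewrite mxE; have := derive_mx (@derivable_id _ _ x u).
by rewrite derive_id => /matrixP/(_ 0 j); rewrite mxE => ->.
Qed.

(** Product rule for [dG] at [f y] applied to [V y]: either the base point moves with [V] frozen, or
    [V] moves. With [V] the derivative of [f] it splits a second derivative of [G] along [f]; with
    [f] the identity it treats vector fields. *)
Lemma dmx_dmx_comp (R : realType) (n q p p' : nat)
    (G : 'rV[R]_q -> 'M[R]_(p, p')) (f V : 'rV[R]_n -> 'rV[R]_q) x u :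
  smooth_near (f x) G -> mdiff f x -> mdiff V x ->
  dmx (fun y => dmx G (f y) (V y)) x u =
  dmx (fun z => dmx G z (V x)) (f x) (dmx f x u) + dmx G (f x) (dmx V x u).
Proof.
move=> sG df dV; apply/matrixP => a b.
rewrite [LHS]mxE [RHS]mxE [X in X + _]mxE.
have dG := smooth_near_mdiff sG.
have d2G j := smooth_near_mdiff (smooth_near_dmx (delta_mx 0 j) sG) a b.
have E : \forall y \near x, dmx G (f y) (V y) a b =
    \sum_j V y 0 j * dmx G (f y) (delta_mx 0 j) a b.
  have cf : {for x, continuous f}.
    exact/differentiable_continuous/mdiff_differentiable.
  have cG : \forall y \near x, smooth_near (f y) G.
    exact: cf _ (smooth_near_nbhs sG).
  apply: filterS cG => y.
  move=> /smooth_near_mdiff dGy; rewrite dmx_sum_delta// summxE.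
  by apply: eq_bigr => j _; rewrite [in LHS]mxE.
rewrite (near_eq_derive _ E) (near_eq_derive _ (dmx_field_sum (fun=> V x) a b sG)).
have dGf j : differentiable (fun y => dmx G (f y) (delta_mx 0 j) a b) x.
  exact: (differentiable_comp_mdiff df (g := fun z => dmx G z _ a b)).
rewrite derive_bigsum => [|j]; last exact: differentiableM.
rewrite derive_bigsum => [|j]; last exact: differentiableM.
rewrite (dmx_sum_delta (dmx V x u) dG) summxE -big_split/=.
apply: eq_bigr => j _; rewrite [X in _ + X]mxE.
rewrite (deriveM (diff_derivable (dV 0 j)) (diff_derivable (dGf j))).
rewrite (deriveMl _ (diff_derivable (d2G j))).
rewrite (derive_comp_mdiff df (g := fun z => dmx G z _ a b))//.
by congr (_ + _); rewrite [dmx V x u 0 j]mxE; exact: mulrC.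
Qed.

Lemma dmx_dmx_field (R : realType) (n p q : nat) (F : 'rV[R]_n -> 'M[R]_(p, q))
    (X : 'rV[R]_n -> 'rV[R]_n) x u : smooth_near x F -> mdiff X x ->
  dmx (fun y => dmx F y (X y)) x u =
  dmx (fun y => dmx F y (X x)) x u + dmx F x (dmx X x u).
Proof.
move=> sF dX; have did : mdiff (@id 'rV[R]_n) x.
  by move=> a b; exact: differentiable_coord.
by rewrite (dmx_dmx_comp u sF did dX) dmx_id.
Qed.

(** * The scalars and their right action *)

Section ScalarMultiplication.
Context {R : realType} {K : scalars}.
Local Notation d := (kdim K).

Definition kmx (s : 'rV[R]_d) : 'M[R]_d :=
  \matrix_(i, j) kmul (kbasis R K i) s 0 j.

Definition kunit (a : nat) : 'M[R]_d := kmx (kbasis R K a).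

Lemma kdim_gt0 : (0 < d)%N. Proof. by case: K. Qed.

End ScalarMultiplication.
Arguments kunit {R} K a.

Section ScalarMultiplicationTheory.
Context {R : realType}.

(** Writing scalars as explicit lists turns associativity into polynomial identities for [ring]. *)
Lemma row2E (x : 'rV[R]_2) : exists a b, x = \row_j [:: a; b]`_j.
Proof.
exists (x 0 0), (x 0 1); apply/rowP => -[[|[|//]] h]; rewrite mxE /=;
  congr (x 0 _); exact: val_inj.
Qed.

Lemma row4E (x : 'rV[R]_4) : exists a b c e, x = \row_j [:: a; b; c; e]`_j.
Proof.
exists (x 0 0), (x 0 1), (x 0 2), (x 0 3).
apply/rowP => -[[|[|[|[|//]]]] h]; rewrite mxE /=;
  congr (x 0 _); exact: val_inj.
Qed.

Lemma cmulE (a b s t : R) :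
  cmul (\row_j [:: a; b]`_j) (\row_j [:: s; t]`_j) =
  \row_j [:: a * s - b * t; a * t + b * s]`_j.
Proof. by apply/rowP => j; rewrite !mxE. Qed.

Lemma hmulE (a b c e s t u v : R) :
  hmul (\row_j [:: a; b; c; e]`_j) (\row_j [:: s; t; u; v]`_j) =
  \row_j [:: a * s - b * t - c * u - e * v; a * t + b * s + c * v - e * u;
             a * u - b * v + c * s + e * t; a * v + b * u - c * t + e * s]`_j.
Proof. by apply/rowP => j; rewrite !mxE. Qed.

Lemma row2_eq (a b s t : R) : a = s -> b = t ->
  \row_(j < 2) [:: a; b]`_j = \row_(j < 2) [:: s; t]`_j.
Proof. by move=> -> ->. Qed.

Lemma row4_eq (a b c e s t u v : R) : a = s -> b = t -> c = u -> e = v ->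
  \row_(j < 4) [:: a; b; c; e]`_j = \row_(j < 4) [:: s; t; u; v]`_j.
Proof. by move=> -> -> -> ->. Qed.

Lemma kmulA K (x s t : 'rV[R]_(kdim K)) : kmul (kmul x s) t = kmul x (kmul s t).
Proof.
case: K x s t => x s t /=.
  have [x0 [x1 ->]] := row2E x; have [s0 [s1 ->]] := row2E s.
  have [t0 [t1 ->]] := row2E t.
  by rewrite !cmulE; apply: row2_eq; rewrite !mxE /=; ring.
have [x0 [x1 [x2 [x3 ->]]]] := row4E x; have [s0 [s1 [s2 [s3 ->]]]] := row4E s.
have [t0 [t1 [t2 [t3 ->]]]] := row4E t.
by rewrite !hmulE; apply: row4_eq; rewrite !mxE /=; ring.
Qed.

Lemma kmulPr K (x : 'rV[R]_(kdim K)) a s t :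
  kmul x (a *: s + t) = a *: kmul x s + kmul x t.
Proof. by case: K x s t => x s t; apply/rowP => j; rewrite !mxE; case: j => -[|[|[|[|//]]]] //= _; ring. Qed.

Lemma kmulPl K (x : 'rV[R]_(kdim K)) a s t :
  kmul (a *: s + t) x = a *: kmul s x + kmul t x.
Proof. by case: K x s t => x s t; apply/rowP => j; rewrite !mxE; case: j => -[|[|[|[|//]]]] //= _; ring. Qed.

Lemma kbasisE K (i : 'I_(kdim K)) : kbasis R K i = delta_mx 0 i.
Proof. by apply/rowP => j; rewrite !mxE. Qed.

Lemma kmulE K (x s : 'rV[R]_(kdim K)) : kmul x s = x *m kmx s.
Proof.
have kmul0 : kmul 0 s = 0 :> 'rV[R]_(kdim K).
  by have := kmulPl s (-1) 0 0; rewrite scaler0 addr0 scaleN1r addNr.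
rewrite mulmx_sum_row {1}(row_sum_delta x).
elim: (index_enum _) => [|i r IH]; first by rewrite !big_nil.
rewrite !big_cons kmulPl IH; congr (_ *: _ + _).
by apply/rowP => j; rewrite !mxE kbasisE.
Qed.

Lemma kmxM K (s t : 'rV[R]_(kdim K)) : kmx s *m kmx t = kmx (kmul s t).
Proof.
apply/row_matrixP => i.
by rewrite row_mul !rowE -!kmulE kmulA.
Qed.

Lemma kmxP K a (s t : 'rV[R]_(kdim K)) : kmx (a *: s + t) = a *: kmx s + kmx t.
Proof. by apply/matrixP => i j; rewrite !mxE kmulPr !mxE. Qed.

Lemma kmx_sum K (s : 'rV[R]_(kdim K)) : kmx s = \sum_a s 0 a *: kunit K a.
Proof.
have kmx0 : kmx 0 = 0 :> 'M[R]_(kdim K).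
  by have := kmxP (-1) 0 (0 : 'rV[R]_(kdim K)); rewrite scaler0 addr0 scaleN1r addNr.
rewrite {1}(row_sum_delta s).
elim: (index_enum _) => [|i r IH]; first by rewrite !big_nil.
by rewrite !big_cons kmxP IH /kunit kbasisE.
Qed.

Lemma kunit0 K : kunit K 0 = 1%:M :> 'M[R]_(kdim K).
Proof.
apply/row_matrixP => i; rewrite !rowE mulmx1 -kmulE.
move: (delta_mx 0 i); case: K i => /= i x; apply/rowP.
  by move=> -[[|[|//]] h]; rewrite !mxE /= !(mulr0, mulr1, oppr0, add0r, addr0);
    congr (x 0 _); exact: val_inj.
by move=> -[[|[|[|[|//]]]] h];
  rewrite !mxE /= !(mulr0, mulr1, oppr0, add0r, addr0);
    congr (x 0 _); exact: val_inj.
Qed.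

(** Polarized form of the composition law |xs| = |x||s|: right multiplication by [s] is a
    similarity. *)
Lemma dot_kmul K (x y s : 'rV[R]_(kdim K)) :
  (kmul x s *m (kmul y s)^T) 0 0 = (x *m y^T) 0 0 * (s *m s^T) 0 0.
Proof.
case: K x y s => x y s /=.
  rewrite !mxE !big_ord_recl !big_ord0 !mxE /=.
  rewrite (_ : lift ord0 ord0 = 1); last exact: val_inj.
  by rewrite (_ : ord0 = 0)//; ring.
rewrite !mxE !big_ord_recl !big_ord0 !mxE /=.
rewrite (_ : lift ord0 ord0 = 1); last exact: val_inj.
rewrite (_ : lift ord0 (lift ord0 ord0) = 2); last exact: val_inj.
rewrite (_ : lift ord0 (lift ord0 (lift ord0 ord0)) = 3); last exact: val_inj.
by rewrite (_ : ord0 = 0)//; ring.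
Qed.

End ScalarMultiplicationTheory.

Section RowDot.
Context {R : realType}.

Definition dotv {r} (u v : 'rV[R]_r) : R := (u *m v^T) 0 0.

Lemma dotvE r (u v : 'rV[R]_r) : dotv u v = \sum_j u 0 j * v 0 j.
Proof. by rewrite /dotv mxE; apply: eq_bigr => j _; rewrite mxE. Qed.

Lemma dotvC r (u v : 'rV[R]_r) : dotv u v = dotv v u.
Proof. by rewrite !dotvE; apply: eq_bigr => j _; rewrite mulrC. Qed.

Lemma dotvDl r (u v w : 'rV[R]_r) : dotv (u + v) w = dotv u w + dotv v w.
Proof. by rewrite /dotv mulmxDl mxE. Qed.

Lemma dotvZl r a (u w : 'rV[R]_r) : dotv (a *: u) w = a * dotv u w.
Proof. by rewrite /dotv -scalemxAl mxE. Qed.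

Lemma dotvNl r (u w : 'rV[R]_r) : dotv (- u) w = - dotv u w.
Proof. by rewrite -scaleN1r dotvZl mulN1r. Qed.

Lemma dotvBl r (u v w : 'rV[R]_r) : dotv (u - v) w = dotv u w - dotv v w.
Proof. by rewrite dotvDl dotvNl. Qed.

Lemma dotv0l r (w : 'rV[R]_r) : dotv 0 w = 0.
Proof. by rewrite /dotv mul0mx mxE. Qed.

Lemma dotv_suml r (I : Type) (s : seq I) (F : I -> 'rV[R]_r) w :
  dotv (\sum_(i <- s) F i) w = \sum_(i <- s) dotv (F i) w.
Proof. by rewrite /dotv mulmx_suml summxE. Qed.

Lemma dotvDr r (u v w : 'rV[R]_r) : dotv w (u + v) = dotv w u + dotv w v.
Proof. by rewrite !(dotvC w) dotvDl. Qed.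

Lemma dotvNr r (u w : 'rV[R]_r) : dotv w (- u) = - dotv w u.
Proof. by rewrite !(dotvC w) dotvNl. Qed.

Lemma dotv_mul r q (u : 'rV[R]_r) (A : 'M[R]_(r, q)) v :
  dotv (u *m A) v = dotv u (v *m A^T).
Proof. by rewrite /dotv trmx_mul trmxK mulmxA. Qed.

Lemma dotv_eq0 r (u : 'rV[R]_r) : (dotv u u == 0) = (u == 0).
Proof.
apply/eqP/eqP => [|->]; last exact: dotv0l.
rewrite dotvE => /eqP; rewrite psumr_eq0 => [/allP h|j _]; last first.
  by rewrite -expr2 sqr_ge0.
apply/rowP => j; rewrite mxE; apply/eqP.
by have := h j (mem_index_enum j); rewrite -expr2 sqrf_eq0.
Qed.

Lemma eq_mulmx_row r q (A B : 'M[R]_(r, q)) :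
  (forall u : 'rV_r, u *m A = u *m B) -> A = B.
Proof. by move=> h; apply/row_matrixP => i; rewrite !rowE. Qed.

End RowDot.

(** Two candidates differ by an element of [S] orthogonal to [S], hence to itself; definiteness then
    identifies the value chosen by [xget]. *)
Lemma oproj_unique (R : realType) (V : zmodType) (ip : V -> V -> R) (S : set V)
    (v u : V) :
  (forall x y z, ip (x - y) z = ip x z - ip y z) ->
  (forall x, ip x x = 0 -> x = 0) ->
  (forall x y, S x -> S y -> S (x - y)) ->
  S u -> (forall s, S s -> ip (v - u) s = 0) -> oproj ip S v = u.
Proof.
move=> ipB ip0 SB Su uP; rewrite /oproj.
have [Sx xP] := @xgetPex _ 0
  [set u | S u /\ forall s, S s -> ip (v - u) s = 0] (ex_intro _ u (conj Su uP)).
set x := xget _ _ in Sx xP *.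
apply/eqP; rewrite -subr_eq0; apply/eqP; apply: ip0.
have E : x - u = (v - u) - (v - x) by rewrite opprB [RHS]addrC subrKA.
by rewrite {1}E ipB uP ?xP ?subrr//; exact: SB.
Qed.

(** * Right multiplications as real matrices *)

Section RightMultiplication.
Context {R : realType} {K : scalars} {N : nat}.
Local Notation d := (kdim K).
Local Notation r := (N * d)%N.

(** Vectors of K^N are flattened to rows of length [N * d], so that real endomorphisms of K^N are
    square matrices and have traces and transposes. *)
Definition kact (s : 'rV[R]_d) : 'M[R]_r := lin_mx (mulmxr (kmx s)).

Definition kact_basis (a : nat) : 'M[R]_r := kact (kbasis R K a).

Lemma kscaleE (v : 'M[R]_(N, d)) s : kscale v s = v *m kmx s.
Proof.
apply/row_matrixP => k; rewrite row_mul -kmulE.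
by apply/rowP => a; rewrite !mxE.
Qed.

Lemma mxvec_kscale (v : 'M[R]_(N, d)) s :
  mxvec (kscale v s) = mxvec v *m kact s.
Proof. by rewrite kscaleE /kact mul_vec_lin. Qed.

Lemma mul_kact (u : 'rV[R]_r) s : u *m kact s = mxvec (vec_mx u *m kmx s).
Proof. by rewrite -[u in LHS]vec_mxK /kact mul_vec_lin. Qed.

Lemma kactM s t : kact s *m kact t = kact (kmul s t).
Proof.
apply: eq_mulmx_row => u.
by rewrite mulmxA !mul_kact mxvecK -mulmxA kmxM.
Qed.

Lemma kactP a s t : kact (a *: s + t) = a *: kact s + kact t.
Proof.
apply: eq_mulmx_row => u; rewrite mulmxDr -scalemxAr !mul_kact kmxP.
by rewrite mulmxDr -scalemxAr linearP.
Qed.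

Lemma kact_sum s : kact s = \sum_(a < d) s 0 a *: kact_basis a.
Proof.
apply: eq_mulmx_row => u; rewrite mul_kact kmx_sum mulmx_sumr linear_sum.
rewrite mulmx_sumr; apply: eq_bigr => a _.
by rewrite -!scalemxAr linearZ mul_kact.
Qed.

Lemma kact_basis0 : kact_basis 0 = 1%:M.
Proof.
apply: eq_mulmx_row => u.
by rewrite mul_kact -/(kunit K 0) kunit0 !mulmx1 vec_mxK.
Qed.

Lemma dotK_mxvec (u v : 'M[R]_(N, d)) : dotK u v = dotv (mxvec u) (mxvec v).
Proof.
rewrite dotvE (reindex _ (curry_mxvec_bij N d)) /dotK pair_bigA/=.
by apply: eq_bigr => -[i j] _ /=; rewrite !mxvecE.
Qed.

Lemma dotK_row (u v : 'M[R]_(N, d)) :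
  dotK u v = \sum_k dotv (row k u) (row k v).
Proof.
apply: eq_bigr => k _; rewrite dotvE.
by apply: eq_bigr => a _; rewrite !mxE.
Qed.

Lemma dotv_kact_norm (u v : 'rV[R]_r) s :
  dotv (u *m kact s) (v *m kact s) = dotv u v * dotv s s.
Proof.
rewrite !mul_kact -dotK_mxvec dotK_row.
rewrite -[u in RHS]vec_mxK -[v in RHS]vec_mxK -dotK_mxvec dotK_row.
rewrite mulr_suml; apply: eq_bigr => k _.
by rewrite !row_mul -!kmulE /dotv dot_kmul.
Qed.

(** Polarization of [dotv_kact_norm] in the scalar. Orthogonality of the [w J_a] and skewness of the
    imaginary units are both special cases. *)
Lemma dotv_kact_polar (u v : 'rV[R]_r) s t :
  dotv (u *m kact s) (v *m kact t) + dotv (u *m kact t) (v *m kact s) =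
  2 * (dotv u v * dotv s t).
Proof.
have := dotv_kact_norm u v (1 *: s + t).
rewrite kactP !scale1r !mulmxDr !dotvDl !dotvDr !dotv_kact_norm (dotvC t s).
move: (dotv (u *m kact s) (v *m kact t)) => A.
move: (dotv (u *m kact t) (v *m kact s)) => B.
by move: (dotv u v) (dotv s s) (dotv s t) (dotv t t) => a b c e h; lra.
Qed.

Lemma dotv_kbasis a b : (a < d)%N -> (b < d)%N ->
  dotv (kbasis R K a) (kbasis R K b) = (a == b)%:R.
Proof.
move=> ad bd; rewrite dotvE (bigD1 (Ordinal ad))//= big1 => [|j ja].
  by rewrite !mxE eqxx mul1r addr0.
by rewrite !mxE (_ : (_ == a) = false) ?mul0r//; exact/negbTE.
Qed.

Lemma dotv_kact_basis a (u v : 'rV[R]_r) : (a < d)%N ->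
  dotv (u *m kact_basis a) (v *m kact_basis a) = dotv u v.
Proof. by move=> ad; rewrite dotv_kact_norm dotv_kbasis// eqxx mulr1. Qed.

Lemma dotv_kact_orthogonal a b (w : 'rV[R]_r) : (a < d)%N -> (b < d)%N ->
  dotv (w *m kact_basis a) (w *m kact_basis b) = dotv w w * (a == b)%:R.
Proof.
move=> ad bd; have := dotv_kact_polar w w (kbasis R K a) (kbasis R K b).
by rewrite (dotvC (w *m kact (kbasis R K b))) dotv_kbasis// => h; lra.
Qed.

Lemma kact_basis_tr a : (0 < a < d)%N -> (kact_basis a)^T = - kact_basis a.
Proof.
move=> /andP[a0 ad]; apply: eq_mulmx_row => u; apply/eqP.
rewrite mulmxN -subr_eq0 opprK -dotv_eq0; apply/eqP.
(* Here [v] is [u J^T + u J]. As an imaginary unit is orthogonal to 1, polarization against the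
   scalar 1 shows that [v] is orthogonal to itself. *)
set v := (X in dotv X X).
have := dotv_kact_polar v u (kbasis R K a) (kbasis R K 0).
rewrite dotv_kbasis ?kdim_gt0// -!/(kact_basis _) kact_basis0 !mulmx1.
rewrite gtn_eqF// !mulr0 dotv_mul => h.
by rewrite -[RHS]h /v dotvDr.
Qed.

End RightMultiplication.

(** * Projections onto lines *)

(** Passes from a sum over all units of K to one over the imaginary units, with the index shift used
    in [acs]. *)
Lemma big_ord_drop0 (V : nmodType) k (F : nat -> V) : (0 < k)%N -> F 0%N = 0 ->
  \sum_(a < k) F a = \sum_(a < k.-1) F a.+1.
Proof. by case: k => // k _ F0; rewrite big_ord_recl F0 add0r. Qed.

(** The matrices act on rows from the right, so [T' *m T] applies [T'] first. *)
Definition curvature_form {R : realType} {r : nat} (T T' : 'M[R]_r) : 'M[R]_r :=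
  T' *m T - T *m T'.

Lemma curvature_formBl (R : realType) (r : nat) (T1 T2 T : 'M[R]_r) :
  curvature_form (T1 - T2) T = curvature_form T1 T - curvature_form T2 T.
Proof.
rewrite /curvature_form mulmxBr mulmxBl.
by apply/matrixP => a b; rewrite !mxE; ring.
Qed.

Lemma curvature_formBr (R : realType) (r : nat) (T1 T2 T : 'M[R]_r) :
  curvature_form T (T1 - T2) = curvature_form T T1 - curvature_form T T2.
Proof.
rewrite /curvature_form mulmxBr mulmxBl.
by apply/matrixP => a b; rewrite !mxE; ring.
Qed.

Section IdempotentDerivative.
Context {R : realType} {r : nat}.
Variables (P T : 'M[R]_r).
Hypothesis eT : T = T *m P + P *m T.

(** The hypothesis is the Leibniz rule for [P P = P]; it says that [T] exchanges the image and the
    kernel of [P]. A product of two such matrices therefore commutes with [P]. *)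
Lemma idem_deriv_mulr : T *m P = (1%:M - P) *m T.
Proof. by rewrite mulmxBl mul1mx {2}eT addrK. Qed.

Lemma idem_deriv_mull : P *m T = T *m (1%:M - P).
Proof. by rewrite mulmxBr mulmx1 {2}eT addrC addKr. Qed.

End IdempotentDerivative.

Lemma idem_deriv_comm (R : realType) (r : nat) (P T T' : 'M[R]_r) :
  T = T *m P + P *m T -> T' = T' *m P + P *m T' ->
  T *m T' *m P = P *m (T *m T').
Proof.
move=> eT eT'; rewrite -mulmxA (idem_deriv_mulr eT') mulmxA.
by rewrite -(idem_deriv_mull eT) mulmxA.
Qed.

(** * The projector of a line and its tangent matrices *)

Section LineProjector.
Context {R : realType} {K : scalars} {N : nat}.
Local Notation d := (kdim K).
Local Notation r := (N * d)%N.
Local Notation J a := (@kact_basis R K N a).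
Implicit Types (w u v : 'rV[R]_r) (A P S T : 'M[R]_r).

(** The vectors [w J_a] form an orthogonal real basis of the line, all of length |w|; this is the
    sum of the rank one projectors onto them. *)
Definition lineproj w : 'M[R]_r :=
  (dotv w w)^-1 *: \sum_(a < d) (w *m J a)^T *m (w *m J a).

(** K-linearity of [A] for the right module structure. *)
Definition equivariant A := forall a, (a < d)%N -> A *m J a = J a *m A.

(* The derivatives of a curve of equivariant symmetric projectors through [P]
   have this form. *)
Definition tangent P T := [/\ T^T = T, equivariant T & T = T *m P + P *m T].

Lemma equivariantM A B : equivariant A -> equivariant B -> equivariant (A *m B).
Proof. by move=> eA eB a ad; rewrite -mulmxA eB// mulmxA eA// mulmxA. Qed.

Lemma equivariantD A B : equivariant A -> equivariant B -> equivariant (A + B).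
Proof. by move=> eA eB a ad; rewrite mulmxDl mulmxDr eA// eB. Qed.

Lemma equivariantN A : equivariant A -> equivariant (- A).
Proof. by move=> eA a ad; rewrite mulNmx mulmxN eA. Qed.

Lemma equivariant_curvature_form T T' :
  equivariant T -> equivariant T' -> equivariant (curvature_form T T').
Proof.
move=> eT eT'; apply: equivariantD; first exact: equivariantM.
exact/equivariantN/equivariantM.
Qed.

Section FixedLine.
Variable w : 'rV[R]_r.
Hypothesis w0 : w != 0.
Local Notation P := (lineproj w).
Local Notation Q := (1%:M - P).

Let n0 : dotv w w != 0. Proof. by rewrite dotv_eq0. Qed.

Lemma mul_lineproj v :
  v *m P = (dotv w w)^-1 *: \sum_(a < d) dotv v (w *m J a) *: (w *m J a).
Proof.
rewrite -scalemxAr mulmx_sumr; congr (_ *: _); apply: eq_bigr => a _.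
by rewrite (mulmxA v) [v *m _]mx11_scalar mul_scalar_mx.
Qed.

Lemma lineproj_tr : P^T = P.
Proof.
rewrite linearZ /= linear_sum; congr (_ *: _); apply: eq_bigr => a _ /=.
by rewrite [LHS]trmx_mul trmxK.
Qed.

Lemma lineproj_kact s : w *m kact s *m P = w *m kact s.
Proof.
rewrite kact_sum mulmx_sumr mulmx_suml; apply: eq_bigr => b _.
rewrite -(scalemxAr _ w) -scalemxAl; congr (_ *: _).
rewrite mul_lineproj (bigD1 b)//= big1 ?addr0 => [|a ab].
  by rewrite dotv_kact_orthogonal// eqxx mulr1 scalerA mulVf// scale1r.
rewrite dotv_kact_orthogonal// (_ : (_ == _) = false) ?mulr0 ?scale0r//.
by apply/negbTE; rewrite eq_sym.
Qed.

Lemma lineproj_gen : w *m P = w.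
Proof.
by have := lineproj_kact (kbasis R K 0); rewrite -/(J 0) kact_basis0 mulmx1.
Qed.

Lemma lineproj_range v : exists s, v *m P = w *m kact s.
Proof.
exists (\row_a ((dotv w w)^-1 * dotv v (w *m J a))).
rewrite mul_lineproj kact_sum scaler_sumr mulmx_sumr; apply: eq_bigr => a _.
by rewrite mxE -scalemxAr scalerA.
Qed.

Lemma lineproj_idem : P *m P = P.
Proof.
apply: eq_mulmx_row => u; rewrite mulmxA; have [s ->] := lineproj_range u.
exact: lineproj_kact.
Qed.

(** The line is stable under [J], so [P J P = P J]; the transpose of this, with [J^T = - J], is
    [P J P = J P]. *)
Lemma lineproj_equivariant : equivariant P.
Proof.
move=> a ad; have PJP b : P *m J b *m P = P *m J b.
  apply: eq_mulmx_row => u; rewrite !mulmxA; have [s ->] := lineproj_range u.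
  by rewrite -[w *m _ *m _]mulmxA kactM lineproj_kact.
case: (posnP a) => [->|a0]; first by rewrite kact_basis0 mulmx1 mul1mx.
have /(congr1 trmx) := PJP a.
rewrite !trmx_mul kact_basis_tr ?a0// lineproj_tr !(mulNmx, mulmxN).
by move=> /oppr_inj; rewrite mulmxA PJP.
Qed.

(** K-linear maps that agree on a generator agree on its line. *)
Lemma lineproj_mul A B : equivariant A -> equivariant B ->
  w *m A = w *m B -> P *m A = P *m B.
Proof.
move=> eA eB AB; rewrite -[P *m A]scalemxAl -[P *m B]scalemxAl !mulmx_suml; congr (_ *: _).
apply: eq_bigr => a _; rewrite -!mulmxA -(eA a)// -(eB a)//.
by rewrite !(mulmxA w) AB.
Qed.

(** By equivariance the [d] basis vectors [w J_a] contribute equally to the trace. *)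
Lemma trace_lineproj A : equivariant A ->
  \tr (P *m A) = d%:R / dotv w w * dotv (w *m A) w.
Proof.
move=> eA; rewrite -scalemxAl linearZ /= mulmx_suml linear_sum /=.
have E a : \tr ((w *m J a)^T *m (w *m J a) *m A) = dotv (w *m J a *m A) (w *m J a).
  by rewrite -mulmxA mxtrace_mulC [_ *m _ in LHS]mx11_scalar mxtrace_scalar mulr1n.
under eq_bigr => a _.
  rewrite E -mulmxA -(eA a)// mulmxA dotv_kact_basis//; over.
by rewrite sumr_const card_ord -[_ *+ d]mulr_natl mulrCA mulrA.
Qed.

Lemma equivariant_compl : equivariant Q.
Proof.
apply: equivariantD; last exact/equivariantN/lineproj_equivariant.
by move=> a ad; rewrite mul1mx mulmx1.
Qed.

Lemma tangent_mulr T : tangent P T -> T *m P = Q *m T.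
Proof. by move=> [_ _]; exact: idem_deriv_mulr. Qed.

Lemma tangent_comm T T' : tangent P T -> tangent P T' ->
  T *m T' *m P = P *m (T *m T').
Proof. by move=> [_ _ e] [_ _ e']; exact: idem_deriv_comm. Qed.

Lemma tangent_gen T : tangent P T -> w *m T *m P = 0.
Proof.
move=> hT; rewrite -mulmxA (tangent_mulr hT) mulmxA mulmxBr mulmx1.
by rewrite lineproj_gen subrr mul0mx.
Qed.

(** Only the off-diagonal blocks of [T] are nonzero; by symmetry the two are transposes of each
    other and contribute equally. *)
Lemma trace_mul_tangent S T : S^T = S -> tangent P T ->
  \tr (S *m T) = \tr (P *m (S *m Q *m T)) *+ 2.
Proof.
move=> Ssym hT; have [Tsym _ e] := hT.
have E2 : \tr (S *m (P *m T)) = \tr (S *m (T *m P)).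
  rewrite -mxtrace_tr !trmx_mul Tsym lineproj_tr Ssym mxtrace_mulC.
  by rewrite mulmxA.
rewrite {1}e mulmxDr linearD /= E2 mulr2n.
suff -> : \tr (S *m (T *m P)) = \tr (P *m (S *m Q *m T)) by [].
rewrite -{1}lineproj_idem (mulmxA T) (tangent_mulr hT) -mulmxA.
by rewrite [RHS]mxtrace_mulC !mulmxA.
Qed.

(** A trace against a tangent matrix sees only the off-diagonal block of [S], which equivariance
    determines from [w S Q]. It is meant for second derivatives of a projector. *)
Lemma trace_mul_offdiag S T T' : S^T = S -> equivariant S ->
  tangent P T -> tangent P T' -> w *m S *m Q = w *m T ->
  \tr (S *m T') = \tr (T *m T').
Proof.
move=> Ssym eS hT hT' ST; have [Tsym eT _] := hT.
rewrite (trace_mul_tangent Ssym hT') (trace_mul_tangent Tsym hT').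
rewrite (mulmxA P (S *m Q)) (mulmxA P (T *m Q)).
suff -> : P *m (S *m Q) = P *m (T *m Q) by [].
apply: lineproj_mul; rewrite ?mulmxA ?ST.
- exact/equivariantM/equivariant_compl.
- exact/equivariantM/equivariant_compl.
by rewrite mulmxBr mulmx1 tangent_gen// subr0.
Qed.

Lemma trace_tangent T T' : tangent P T -> tangent P T' ->
  \tr (T *m T') = 2 * d%:R / dotv w w * dotv (w *m T) (w *m T').
Proof.
move=> hT hT'; have [Tsym eT _] := hT; have [T'sym eT' _] := hT'.
rewrite (trace_mul_tangent Tsym hT').
have -> : T *m Q *m T' = T *m T' *m P.
  by rewrite -mulmxA -(tangent_mulr hT') mulmxA.
rewrite (mxtrace_mulC P) -(mulmxA (T *m T')) lineproj_idem mxtrace_mulC trace_lineproj; last first.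
  exact: equivariantM.
by rewrite mulmxA (dotv_mul _ T') T'sym -[_ *+ 2]mulr_natl !mulrA.
Qed.

(** Since [T' P = Q T'], the compression inserts [Q] after [S], and [P S Q = P T]. *)
Lemma offdiag_comm S T T' : equivariant S -> tangent P T -> tangent P T' ->
  w *m S *m Q = w *m T -> P *m (S *m T') *m P = P *m (T *m T').
Proof.
move=> eS hT hT' ST; have [Tsym eT _] := hT.
rewrite -!mulmxA (tangent_mulr hT') (mulmxA S) mulmxA (mulmxA _ T).
congr (_ *m _); apply: lineproj_mul => //; last by rewrite mulmxA.
exact/equivariantM/equivariant_compl.
Qed.

(** The left side is the Leibniz derivative of a commutator, compressed to the line; each second
    derivative may be replaced there by the tangent matrix with the same off-diagonal block. *)
Lemma curvature_form_derivative SX SY TX TY TX' TY' :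
  SX^T = SX -> equivariant SX -> SY^T = SY -> equivariant SY ->
  tangent P TX -> tangent P TY -> tangent P TX' -> tangent P TY' ->
  w *m SX *m Q = w *m TX' -> w *m SY *m Q = w *m TY' ->
  P *m (SY *m TX + TY *m SX - (SX *m TY + TX *m SY)) *m P =
  P *m (curvature_form TX' TY + curvature_form TX TY').
Proof.
move=> symX eX symY eY hX hY hX' hY' eqX eqY.
(* The transpose of [offdiag_comm], for products with the second derivative on the right. *)
have tr_comm S T T' : S^T = S -> equivariant S -> tangent P T ->
    tangent P T' -> w *m S *m Q = w *m T ->
    P *m (T' *m S) *m P = P *m (T' *m T).
  move=> Ssym eS hT hT' /(offdiag_comm eS hT hT')/(congr1 trmx).
  have [Tsym _ _] := hT; have [T'sym _ _] := hT'.
  rewrite !trmx_mul lineproj_tr Ssym Tsym T'sym => E.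
  by rewrite -mulmxA E -tangent_comm// mulmxA.
rewrite mulmxBr !mulmxDr mulmxBl !mulmxDl.
rewrite (offdiag_comm eY hY' hX eqY) (offdiag_comm eX hX' hY eqX).
rewrite (tr_comm _ _ _ symX eX hX' hY eqX) (tr_comm _ _ _ symY eY hY' hX eqY).
by rewrite /curvature_form !mulmxN opprD [X in X + _ = _]addrC [RHS]addrACA.
Qed.

Lemma curvature_form_range T T' : tangent P T -> tangent P T' ->
  w *m curvature_form T T' *m P = w *m curvature_form T T'.
Proof.
move=> hT hT'; rewrite -mulmxA mulmxBl !tangent_comm// -mulmxBr mulmxA.
by rewrite lineproj_gen.
Qed.

Lemma curvature_form_gen T T' : tangent P T -> tangent P T' ->
  w *m curvature_form T T' =
  \sum_(a < d.-1) (2 / dotv w w * dotv (w *m T *m J a.+1) (w *m T')) *: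
    (w *m J a.+1).
Proof.
move=> hT hT'; have [Tsym eT _] := hT; have [T'sym eT' _] := hT'.
pose F a := dotv (w *m curvature_form T T') (w *m J a).
(* Along [w] itself both halves of the commutator give the inner product of [w T] and [w T'], so
   they cancel: the curvature is purely imaginary. *)
have F0 : F 0%N = 0.
  rewrite /F kact_basis0 mulmx1 mulmxBr dotvBl !mulmxA.
  rewrite (dotv_mul (w *m T)) T'sym (dotv_mul (w *m T')) Tsym dotvC.
  by rewrite subrr.
(* Along [w J] the skewness of [J] turns the cancellation into a doubling. *)
have FS a : (0 < a < d)%N -> F a = 2 * dotv (w *m T *m J a) (w *m T').
  move=> ad; have /andP[a0 a1] := ad.
  have flip u v : dotv u (v *m J a) = - dotv (u *m J a) v.
    by rewrite dotv_mul kact_basis_tr// mulmxN dotvNr opprK.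
  have E A B : A^T = A -> equivariant A -> B^T = B -> equivariant B ->
      dotv (w *m (A *m B)) (w *m J a) = - dotv (w *m A *m J a) (w *m B).
    move=> _ eA Bsym eB; rewrite flip -mulmxA -!(mulmxA A) eB// mulmxA.
    by rewrite mulmxA (dotv_mul _ B) Bsym.
  rewrite /F mulmxBr dotvBl !E// dotvC flip.
  by rewrite -(opprK (dotv (w *m T *m J a) _)); ring.
rewrite -curvature_form_range// mul_lineproj -/(F _).
have -> : \sum_(a < d) F a *: (w *m J a) =
    \sum_(a < d.-1) F a.+1 *: (w *m J a.+1).
  apply: (@big_ord_drop0 _ _ (fun a => F a *: (w *m J a))); first exact: kdim_gt0.
  by rewrite F0 scale0r.
rewrite scaler_sumr; apply: eq_bigr => a _.
rewrite FS; last by rewrite /= -ltn_predRL.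
by rewrite scalerA; congr (_ *: _); rewrite mulrA [_^-1 * _]mulrC.
Qed.

End FixedLine.
End LineProjector.

(** * Levi-Civita connections of trace metrics *)

Section SmoothInverse.
Context {R : realType} {n : nat}.
Implicit Types (x u v : 'rV[R]_n) (U : set 'rV[R]_n).

Lemma Ck_prod k U (I : Type) (s : seq I) (f : I -> 'rV[R]_n -> R) : open U ->
  (forall i, Ck k U (f i)) -> Ck k U (fun x => \prod_(i <- s) f i x).
Proof.
move=> oU h; elim: s => [|i s IH].
  by apply: Ck_ext (Ck_cst k U 1) => x; rewrite big_nil.
by apply: Ck_ext (CkM oU (h i) IH) => x; rewrite big_cons.
Qed.

Lemma Ck_det k U p (F : 'rV[R]_n -> 'M[R]_p) : open U -> smooth_on U F ->
  Ck k U (fun y => \det (F y)).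
Proof.
move=> oU sF; apply: Ck_sum => // s _; apply: CkM => //; first exact: Ck_cst.
by apply: Ck_prod => // i; exact: sF.
Qed.

(** Cramer's formula, on the open set where the determinant does not vanish. *)
Lemma smooth_near_invmx p (F : 'rV[R]_n -> 'M[R]_p) x :
  smooth_near x F -> F x \in unitmx -> smooth_near x (fun y => invmx (F y)).
Proof.
move=> [U [oU Ux sF]]; rewrite unitmxE unitfE => dx.
pose V := [set y | \det (F y) != 0]^°.
have Vx : V x.
  have cdet : \det (F y) @[y --> x] --> \det (F x) := Ck_det 0 oU sF x Ux.
  have h : \forall y \near x, \det (F y) != 0 by exact: cvgr_neq0 cdet dx.
  exact: h.
have oUV : open (U `&` V) by apply: openI => //; exact: open_interior.
have sF' : smooth_on (U `&` V) F by exact: smooth_on_sub (@subIsetl _ _ _) sF.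
exists (U `&` V); split => // i j k.
apply: (Ck_eq (f := fun y => (\det (F y))^-1 * cofactor (F y) j i)) => //.
  move=> y [_ /interior_subset/= dy].
  by rewrite /invmx unitmxE unitfE dy !mxE.
apply: CkM => //; first apply: CkV => //.
- by move=> y [_ /interior_subset].
- exact: Ck_det.
apply: CkM => //; first exact: Ck_cst.
apply: Ck_det => // a b l; apply: Ck_ext (sF' (lift j a) (lift i b) l) => y.
by rewrite !mxE.
Qed.

End SmoothInverse.

Section LeviCivitaConnection.
Context {R : realType} {n : nat}.
Implicit Types (x u v w : 'rV[R]_n) (g : 'rV[R]_n -> 'M[R]_n).

(** The terms of [Dcurv] that contain [covd] are curvatures along these fields; evaluating them
    requires the fields to be differentiable. *)
Lemma smooth_near_covd g (X Y : 'rV[R]_n -> 'rV[R]_n) x :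
  smooth_near x g -> g x \in unitmx -> smooth_near x X -> smooth_near x Y ->
  smooth_near x (covd g X Y).
Proof.
move=> sg gx sX sY; apply: smooth_nearD; first exact: smooth_near_dmx_field.
have [U [oU Ux Ug Ui]] := smooth_near2 sg (smooth_near_invmx sg gx).
have [V [oV Vx VX VY]] := smooth_near2 sX sY.
have oUV : open (U `&` V) by exact: openI.
exists (U `&` V); split => // a k l.
have {}Ug := smooth_on_sub (@subIsetl _ U V) Ug.
have {}Ui := smooth_on_sub (@subIsetl _ U V) Ui.
have {}VX := smooth_on_sub (@subIsetr _ U V) VX.
have {}VY := smooth_on_sub (@subIsetr _ U V) VY.
apply: (Ck_ext (f := fun y =>
  \sum_i \sum_j christoffel g y i j k * X y 0 i * Y y 0 j)).
  by move=> y; rewrite mxE.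
have sd i j m : Ck l (U `&` V) (fun y => dmetric g y m i j).
  by have [_ /(_ (delta_mx 0 m))] := Ug i j l.+1.
apply: Ck_sum => // i _; apply: Ck_sum => // j _.
apply: CkM => //; apply: CkM => //.
apply: CkM => //; first exact: Ck_cst.
apply: Ck_sum => // m _; apply: CkM => //.
apply: CkD => //; first exact: CkD.
apply: (Ck_ext (f := fun y => -1 * dmetric g y m i j)).
  by move=> y; rewrite mulN1r.
by apply: CkM => //; exact: Ck_cst.
Qed.

Lemma derive_trace p (F : 'rV[R]_n -> 'M[R]_p) x v : mdiff F x ->
  'D_v (fun y => \tr (F y)) x = \tr (dmx F x v).
Proof.
move=> dF; rewrite derive_bigsum => [|i]; last exact: dF.
by apply: eq_bigr => i _; rewrite mxE.
Qed.

Section TraceMetric.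
Variables (p : nat) (F : 'rV[R]_n -> 'M[R]_p) (lam : R) (x : 'rV[R]_n).
Hypothesis sF : smooth_near x F.

Definition trace_metric (y : 'rV[R]_n) : 'M[R]_n := \matrix_(i, j)
  (lam * \tr (dmx F y (delta_mx 0 i) *m dmx F y (delta_mx 0 j))).

Lemma smooth_near_trace_metric : smooth_near x trace_metric.
Proof.
have [U [oU Ux UF]] := sF; exists U; split => // i j k.
apply: (Ck_ext (f := fun y =>
    lam * \tr (dmx F y (delta_mx 0 i) *m dmx F y (delta_mx 0 j)))).
  by move=> y; rewrite mxE.
apply: CkM => //; first exact: Ck_cst.
apply: Ck_sum => // a _; apply: smooth_onM => //; exact: smooth_on_dmx.
Qed.

Lemma bform_trace_metric u v : bform (trace_metric x) u v =
  lam * \tr (dmx F x u *m dmx F x v).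
Proof.
have dF := smooth_near_mdiff sF.
rewrite (dmx_sum_delta u dF) (dmx_sum_delta v dF) mulmx_suml linear_sum/=.
rewrite /bform -mulmxA mxE mulr_sumr; apply: eq_bigr => i _.
rewrite mxE -scalemxAl linearZ /= mulmx_sumr linear_sum/= !mulr_sumr.
by apply: eq_bigr => j _; rewrite !mxE -scalemxAr linearZ /=; ring.
Qed.

Lemma dmetric_trace_metric l i j :
  let D a := dmx F x (delta_mx 0 a) in
  let D2 a b := dmx (fun y => dmx F y (delta_mx 0 b)) x (delta_mx 0 a) in
  dmetric trace_metric x l i j =
  lam * (\tr (D2 l i *m D j) + \tr (D2 l j *m D i)).
Proof.
move=> D D2; pose H i j y := dmx F y (delta_mx 0 i) *m dmx F y (delta_mx 0 j).
have dF a : mdiff (fun y => dmx F y (delta_mx 0 a)) x.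
  exact: smooth_near_mdiff (smooth_near_dmx _ sF).
have dH : mdiff (H i j) x by exact: mdiffM.
have E : (fun y => trace_metric y i j) = fun y => lam * \tr (H i j y).
  by apply/funext => y; rewrite mxE.
rewrite /dmetric E.
have dtr : differentiable (fun y => \tr (H i j y)) x.
  by apply: differentiable_bigsum => a; exact: dH.
have -> : (fun y => lam * \tr (H i j y)) = lam *: (fun y => \tr (H i j y)) by [].
rewrite (deriveZ _ (diff_derivable dtr)) derive_trace// dmxM// linearD /=.
by rewrite [X in _ + X]mxtrace_mulC.
Qed.

Hypothesis gx : trace_metric x \in unitmx.

(** As for a submanifold of Euclidean space, the Levi-Civita connection is the tangential part of
    the second derivative of [F]. *)
Lemma christoffel_trace_metric u v w :
  bform (trace_metric x) (christoffel_map trace_metric x u v) w =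
  lam * \tr (dmx (fun y => dmx F y v) x u *m dmx F x w).
Proof.
have dF := smooth_near_mdiff sF.
have d2F a := smooth_near_mdiff (smooth_near_dmx a sF).
pose D a := dmx F x (delta_mx 0 a).
pose D2 a b := dmx (fun y => dmx F y (delta_mx 0 b)) x (delta_mx 0 a).
have D2C a b : D2 a b = D2 b a by exact: dmx_comm.
pose g := trace_metric x.
have gsym : g^T = g.
  apply/matrixP => i j; rewrite [LHS]mxE [LHS]mxE [RHS]mxE.
  by move: (dmx F x _) (dmx F x _) => A B; rewrite mxtrace_mulC.
pose tau := \row_l (lam * \tr (dmx (fun y => dmx F y v) x u *m D l)).
have D2uv : dmx (fun y => dmx F y v) x u = \sum_i \sum_j (u 0 i * v 0 j) *: D2 i j.
  rewrite (dmx_sum_delta u (d2F v)); apply: eq_bigr => i _.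
  rewrite dmx_comm// (dmx_sum_delta v (d2F _)) scaler_sumr.
  by apply: eq_bigr => j _; rewrite scalerA -/(D2 j i) D2C.
have dm l i j : dmetric trace_metric x l i j =
    lam * (\tr (D2 l i *m D j) + \tr (D2 l j *m D i)).
  exact: dmetric_trace_metric.
have chE i j k : christoffel trace_metric x i j k =
    \sum_l invmx g k l * (lam * \tr (D2 i j *m D l)).
  rewrite /christoffel mulr_sumr; apply: eq_bigr => l _.
  rewrite !dm -/g; move: (invmx g k l) => c.
  (* Symmetry of second derivatives in the first two slots leaves [2 T i j l] of the six terms in
     the Christoffel symbol. *)
  have koszul (T : 'I_n -> 'I_n -> 'I_n -> R) :
      (forall a b e, T a b e = T b a e) ->
      2^-1 * (c * (lam * (T i j l + T i l j) + lam * (T j i l + T j l i) -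
        lam * (T l i j + T l j i))) = c * (lam * T i j l).
    by move=> Tsym; rewrite (Tsym j i) (Tsym l i) (Tsym l j); field.
  by apply: (koszul (fun a b e => \tr (D2 a b *m D e))) => a b e; rewrite D2C.
have chmE : christoffel_map trace_metric x u v = tau *m invmx g.
  apply/rowP => k; rewrite mxE.
  have -> : (tau *m invmx g) 0 k = \sum_l invmx g k l * tau 0 l.
    rewrite mxE; apply: eq_bigr => l _; rewrite mulrC.
    by rewrite -{1}gsym -trmx_inv mxE.
  under eq_bigr => i _ do under eq_bigr => j _ do
    rewrite chE !mulr_suml.
  under eq_bigr do rewrite exchange_big.
  rewrite exchange_big; apply: eq_bigr => l _.
  rewrite [tau 0 l]mxE D2uv mulmx_suml linear_sum !mulr_sumr.
  apply: eq_bigr => i _; rewrite mulmx_suml linear_sum !mulr_sumr.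
  by apply: eq_bigr => j _; rewrite -scalemxAl linearZ /=; ring.
rewrite /bform chmE mulmxKV// mxE.
rewrite (dmx_sum_delta w dF) mulmx_sumr linear_sum mulr_sumr.
apply: eq_bigr => l _; rewrite -scalemxAr linearZ /= !mxE.
by rewrite mulrAC -mulrA.
Qed.

End TraceMetric.
End LeviCivitaConnection.

(** * The projected connection and its curvature *)

Section ProjectedConnection.
Context {R : realType} {K : scalars} {n N : nat}.
Local Notation r := (N * kdim K)%N.
Variables (sigma : 'rV[R]_n -> set ('M[R]_(N, kdim K))) (P : 'rV[R]_n -> 'M[R]_r).
Implicit Types (X Y Z : 'rV[R]_n -> 'rV[R]_n)
  (W : 'rV[R]_n -> 'M[R]_(N, kdim K)) (x : 'rV[R]_n).

(** The curvature computation uses the fibres only through these three facts, so it applies to any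
    smooth field of subspaces. *)
Definition projects_onto x :=
  [/\ P x *m P x = P x,
      (forall v, oproj (@dotK R K N) (sigma x) v = vec_mx (mxvec v *m P x)) &
      (forall v, sigma x v <-> mxvec v *m P x = mxvec v)].

Definition projection_field x :=
  smooth_near x P /\ \forall y \near x, projects_onto y.

Lemma projection_field_near x : projection_field x ->
  \forall y \near x, projection_field y.
Proof.
move=> [sP pP]; have pP' : \forall y \near x, \forall z \near y, projects_onto z.
  exact: nbhs_interior pP.
by apply: filterS (filterI (smooth_near_nbhs sP) pP') => y [].
Qed.

Lemma is_section_near x W : is_section sigma x W ->
  \forall y \near x, is_section sigma y W.
Proof.
move=> [sW W_s].
have W_s' : \forall y \near x, \forall z \near y, sigma z (W z).
  exact: nbhs_interior W_s.
by apply: filterS (filterI (smooth_near_nbhs sW) W_s') => y [].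
Qed.

Lemma mdiff_mxvec W x : mdiff W x -> mdiff (fun y => mxvec (W y)) x.
Proof. exact: (mdiff_lin mxvec). Qed.

Lemma dmx_mxvec W x v : mdiff W x ->
  dmx (fun y => mxvec (W y)) x v = mxvec (dmx W x v).
Proof. exact: (dmx_lin mxvec). Qed.

Section AtPoint.
Variable x : 'rV[R]_n.
Hypothesis pf : projection_field x.

Let sP : smooth_near x P. Proof. by have [] := pf. Qed.
Let dP : mdiff P x. Proof. exact: smooth_near_mdiff. Qed.
Let px : projects_onto x. Proof. by have [_ /nbhs_singleton] := pf. Qed.
Let idem : P x *m P x = P x. Proof. by have [] := px. Qed.

Lemma projection_deriv u : dmx P x u = dmx P x u *m P x + P x *m dmx P x u.
Proof.
rewrite -dmxM//; apply: near_eq_dmx; have [_] := pf.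
by apply: filterS => y [].
Qed.

(** Differentiate [W = W P]. The normal part of the derivative of a section is of order zero in the
    section, which is why the curvature is a tensor. *)
Lemma section_deriv W u : is_section sigma x W ->
  mxvec (dmx W x u) *m (1%:M - P x) = mxvec (W x) *m dmx P x u.
Proof.
move=> [sW W_s]; have dW := smooth_near_mdiff sW.
have E : dmx (fun y => mxvec (W y) *m P y) x u = mxvec (dmx W x u).
  rewrite -dmx_mxvec//; apply: near_eq_dmx; have [_ pP] := pf.
  by apply: filterS (filterI pP W_s) => y [[_ _ h] /h].
rewrite dmxM// in E; last exact: mdiff_mxvec.
by rewrite mulmxBr mulmx1 -{1}E dmx_mxvec// addrC addKr.
Qed.

Lemma mxvec_conn X W : mxvec (conn sigma X W x) = mxvec (dmx W x (X x)) *m P x.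
Proof. by rewrite /conn; have [_ -> _] := px; rewrite vec_mxK. Qed.

End AtPoint.

Lemma conn_near x X W : projection_field x ->
  \forall y \near x, conn sigma X W y = vec_mx (mxvec (dmx W y (X y)) *m P y).
Proof.
move=> /projection_field_near; apply: filterS => y pf.
by apply: (can_inj mxvecK); rewrite vec_mxK mxvec_conn.
Qed.

Lemma is_section_conn x X W : projection_field x -> smooth_near x X ->
  smooth_near x W -> is_section sigma x (conn sigma X W).
Proof.
move=> pf sX sW; split.
  apply: (smooth_near_eq (F := fun y => vec_mx (mxvec (dmx W y (X y)) *m P y))).
    by apply: filterS (conn_near X W pf) => y ->.
  apply: (smooth_near_lin vec_mx); apply: smooth_nearM; last by have [] := pf.
  by apply: (smooth_near_lin mxvec); exact: smooth_near_dmx_field.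
have [_ pP] := pf.
apply: filterS (filterI pP (projection_field_near pf)) => y [[idem _ h] pfy].
by apply/h; rewrite mxvec_conn// -mulmxA idem.
Qed.

Lemma mxvec_conn_conn x X Y W : projection_field x -> mdiff Y x ->
  smooth_near x W ->
  mxvec (conn sigma X (conn sigma Y W) x) =
  mxvec (dmx (fun y => dmx W y (Y x)) x (X x) + dmx W x (dmx Y x (X x))) *m P x +
  mxvec (dmx W x (Y x)) *m dmx P x (X x) *m P x.
Proof.
move=> pf dY sW; have [sP /nbhs_singleton[idem _ _]] := pf.
have dP := smooth_near_mdiff sP; have dWY := mdiff_dmx_field sW dY.
rewrite mxvec_conn// (near_eq_dmx _ (conn_near Y W pf)).
have dm : mdiff (fun y => mxvec (dmx W y (Y y)) *m P y) x.
  by apply: mdiffM => //; exact: (mdiff_lin mxvec).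
rewrite (dmx_lin vec_mx)// vec_mxK dmxM//; last exact: (mdiff_lin mxvec).
by rewrite (dmx_lin mxvec)// dmx_dmx_field// mulmxDl -mulmxA idem.
Qed.

(** Second derivatives of [W] cancel by symmetry and derivatives of [X] and [Y] cancel against the
    bracket; what remains is the derivative of the projector inside the iterated connection. *)
Lemma mxvec_curv x X Y W : projection_field x -> mdiff X x -> mdiff Y x ->
  is_section sigma x W ->
  mxvec (curv sigma X Y W x) =
  mxvec (W x) *m curvature_form (dmx P x (X x)) (dmx P x (Y x)).
Proof.
move=> pf dX dY secW; have [sW _] := secW; have dW := smooth_near_mdiff sW.
have mxvecB (A B : 'M[R]_(N, kdim K)) : mxvec (A - B) = mxvec A - mxvec B.
  exact: linearB.
have mxvecD (A B : 'M[R]_(N, kdim K)) : mxvec (A + B) = mxvec A + mxvec B.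
  exact: linearD.
(* Moving [P] across its derivative turns it into [1 - P] next to the derivative of [W], where
   [section_deriv] applies. *)
have E Z V : mxvec (dmx W x (Z x)) *m dmx P x (V x) *m P x =
    mxvec (W x) *m (dmx P x (Z x) *m dmx P x (V x)).
  rewrite -mulmxA (idem_deriv_mulr (projection_deriv pf _)) mulmxA.
  by rewrite section_deriv// mulmxA.
have eA := mxvec_conn_conn X pf dY sW; rewrite (E Y X) in eA.
have eB := mxvec_conn_conn Y pf dX sW; rewrite (E X Y) in eB.
rewrite (dmx_comm (Y x) (X x) sW) in eB.
have eC := mxvec_conn pf (lie_bracket X Y) W.
rewrite /lie_bracket (dmxBv _ _ dW) in eC.
move: eA eB eC; rewrite /curv.
move: (conn sigma X (conn sigma Y W) x) (conn sigma Y (conn sigma X W) x) => A B.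
move: (conn _ _ _ x) => C eA eB eC; rewrite !mxvecB {}eA {}eB {}eC.
rewrite /curvature_form mulmxBr; move: (dmx _ x _) => a.
move: (dmx _ x (dmx X _ _)) (dmx _ x (dmx Y _ _)) => c b.
move: (mxvec (W x) *m (dmx P x (Y x) *m dmx P x (X x))) => e.
move: (mxvec (W x) *m (dmx P x (X x) *m dmx P x (Y x))) => f.
rewrite mxvecB !mxvecD mulmxBl !mulmxDl.
move: (mxvec a *m _) (mxvec b *m _) (mxvec c *m _) => {}a {}b {}c.
by apply/rowP => k; rewrite !mxE; ring.
Qed.

(** Leibniz rule for the curvature: derivatives of [W] cancel against the term with
    [conn sigma Z W], those of [X] and [Y] against the coordinate part of [covd]. Only the
    Christoffel part survives, and the result depends on point values. *)
Lemma mxvec_Dcurv (g : 'rV[R]_n -> 'M[R]_n) x Z X Y W :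
  let PX := dmx P x (X x) in let PY := dmx P x (Y x) in
  let PZX := dmx (fun y => dmx P y (X x)) x (Z x) in
  let PZY := dmx (fun y => dmx P y (Y x)) x (Z x) in
  projection_field x -> smooth_near x X -> smooth_near x Y ->
  smooth_near x Z -> smooth_near x (covd g Z X) -> smooth_near x (covd g Z Y) ->
  is_section sigma x W ->
  mxvec (Dcurv g sigma Z X Y W x) = mxvec (W x) *m
    ((PZY *m PX + PY *m PZX - (PZX *m PY + PX *m PZY)) *m P x -
     curvature_form (dmx P x (christoffel_map g x (Z x) (X x))) PY -
     curvature_form PX (dmx P x (christoffel_map g x (Z x) (Y x)))).
Proof.
move=> PX PY PZX PZY pf sX sY sZ sGX sGY secW.
have [sW _] := secW; have dW := smooth_near_mdiff sW; have [sP _] := pf.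
have dP := smooth_near_mdiff sP.
have dX := smooth_near_mdiff sX; have dY := smooth_near_mdiff sY.
have mxvecB (A B : 'M[R]_(N, kdim K)) : mxvec (A - B) = mxvec A - mxvec B.
  exact: linearB.
pose Rm y := curvature_form (dmx P y (X y)) (dmx P y (Y y)).
(* The curvature is differentiated next, so its formula is required on a neighbourhood. *)
have curv_near : \forall y \near x,
    curv sigma X Y W y = vec_mx (mxvec (W y) *m Rm y).
  near=> y.
  have pfy : projection_field y by near: y; exact: projection_field_near.
  have secy : is_section sigma y W by near: y; exact: is_section_near.
  have dXy : mdiff X y.
    by apply: smooth_near_mdiff; near: y; exact: smooth_near_nbhs.
  have dYy : mdiff Y y.
    by apply: smooth_near_mdiff; near: y; exact: smooth_near_nbhs.
  by apply: (can_inj mxvecK); rewrite vec_mxK mxvec_curv.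
have dPX := mdiff_dmx_field sP dX; have dPY := mdiff_dmx_field sP dY.
have dRm : mdiff Rm x by apply: mdiffB; exact: mdiffM.
have eP := projection_deriv pf.
have P_Rm A B : curvature_form (dmx P x A) (dmx P x B) *m P x =
    P x *m curvature_form (dmx P x A) (dmx P x B).
  by rewrite mulmxBl mulmxBr; congr (_ - _); exact: idem_deriv_comm.
have WP : mxvec (W x) *m P x = mxvec (W x).
  by have [_ /nbhs_singleton[_ _ h]] := pf; apply/h; have [_ /nbhs_singleton] := secW.
have [sC _] := is_section_conn pf sZ sW.
have secC := is_section_conn pf sZ sW.
have eX : dmx (fun y => dmx P y (X y)) x (Z x) = PZX + dmx P x (dmx X x (Z x)).
  exact: dmx_dmx_field.
have eY : dmx (fun y => dmx P y (Y y)) x (Z x) = PZY + dmx P x (dmx Y x (Z x)).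
  exact: dmx_dmx_field.
have e1 : mxvec (conn sigma Z (curv sigma X Y W) x) =
    (mxvec (dmx W x (Z x)) *m Rm x + mxvec (W x) *m
      (PY *m (PZX + dmx P x (dmx X x (Z x))) +
       (PZY + dmx P x (dmx Y x (Z x))) *m PX -
       (PX *m (PZY + dmx P x (dmx Y x (Z x))) +
       (PZX + dmx P x (dmx X x (Z x))) *m PY))) *m P x.
  rewrite mxvec_conn// (near_eq_dmx _ curv_near) (dmx_lin vec_mx); last first.
    by apply: mdiffM => //; exact: mdiff_mxvec.
  rewrite vec_mxK dmxM//; last exact: mdiff_mxvec.
  rewrite dmx_mxvec// /Rm dmxB; [|exact: mdiffM|exact: mdiffM].
  rewrite (dmxM _ dPY dPX) (dmxM _ dPX dPY) eX eY.
  by rewrite [X in _ + _ *m (X - _)]addrC [X in _ + _ *m (_ - X)]addrC.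
have e2 := mxvec_curv pf (smooth_near_mdiff sGX) dY secW.
have e3 := mxvec_curv pf dX (smooth_near_mdiff sGY) secW.
have e4 := mxvec_curv pf dX dY secC.
rewrite mxvec_conn// -mulmxA -P_Rm in e4.
have eGX : dmx P x (covd g Z X x) = dmx P x (dmx X x (Z x)) +
    dmx P x (christoffel_map g x (Z x) (X x)) by exact: dmxDv.
have eGY : dmx P x (covd g Z Y x) = dmx P x (dmx Y x (Z x)) +
    dmx P x (christoffel_map g x (Z x) (Y x)) by exact: dmxDv.
rewrite eGX in e2; rewrite eGY in e3; rewrite /Dcurv.
have W_Rm A B : mxvec (W x) *m curvature_form (dmx P x A) (dmx P x B) *m P x =
    mxvec (W x) *m curvature_form (dmx P x A) (dmx P x B).
  move: (curvature_form _ _) (mxvec (W x)) (P_Rm A B) WP => C om CP omP.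
  by rewrite -mulmxA CP mulmxA omP.
have R1 := W_Rm (dmx X x (Z x)) (Y x); have R2 := W_Rm (X x) (dmx Y x (Z x)).
rewrite -/PX -/PY in e1 e2 e3 e4 R1 R2 *.
rewrite /Rm -/PX -/PY in e1.
move: e1 e2 e3 e4 R1 R2.
move: (conn sigma Z _ x) (curv sigma (covd g Z X) Y W x) => A1 A2.
move: (curv sigma X (covd g Z Y) W x) (curv sigma X Y (conn sigma Z W) x) => A3 A4.
move: (dmx P x (dmx X x _)) (dmx P x (dmx Y x _)) => a b.
move: (dmx P x (christoffel_map _ _ _ (X x))) => c.
move: (dmx P x (christoffel_map _ _ _ (Y x))) => e.
move: (mxvec (W x)) (mxvec (dmx W x _)) => om om'.
clearbody PX PY PZX PZY => e1 e2 e3 e4 R1 R2.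
rewrite !mxvecB {}e1 {}e2 {}e3 {}e4.
have EM : PY *m (PZX + a) + (PZY + b) *m PX -
    (PX *m (PZY + b) + (PZX + a) *m PY) =
    PZY *m PX + PY *m PZX - (PZX *m PY + PX *m PZY) +
    (curvature_form a PY + curvature_form PX b).
  rewrite /curvature_form !mulmxDr !mulmxDl.
  by apply/matrixP => i j; rewrite !mxE; ring.
have cD1 : curvature_form (a + c) PY = curvature_form a PY + curvature_form c PY.
  rewrite /curvature_form mulmxDr mulmxDl.
  by apply/matrixP => i j; rewrite !mxE; ring.
have cD2 : curvature_form PX (b + e) = curvature_form PX b + curvature_form PX e.
  rewrite /curvature_form mulmxDr mulmxDl.
  by apply/matrixP => i j; rewrite !mxE; ring.
rewrite EM cD1 cD2 {EM cD1 cD2}; move: R1 R2.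
move: (curvature_form a PY) (curvature_form PX b) => c1 c2.
move: (curvature_form c PY) (curvature_form PX e) (curvature_form PX PY).
move: (_ + _ - _) => L c3 c4 c5 R1 R2.
rewrite (mulmxDr om L) (mulmxDl (om' *m _)) (mulmxDl (om *m L)).
rewrite (mulmxDr om c1 c2) (mulmxDl (om *m c1)) R1 R2 (mulmxDr om c1 c3).
rewrite (mulmxDr om c2 c4) (mulmxBr om _ c4) (mulmxBr om _ c3) !mulmxA.
move: (om' *m _ *m _) (om *m L *m _) (om *m c1) (om *m c2) => {}a {}b {}c {}e.
by apply/rowP => k; rewrite !mxE; ring.
Unshelve. all: by end_near. Qed.

End ProjectedConnection.

(** * Fields of lines and affine charts *)

Section LineField.
Context {R : realType} {K : scalars} {n N : nat}.
Local Notation d := (kdim K).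
Local Notation r := (N * d)%N.
Local Notation J a := (@kact_basis R K N a).
Implicit Types (x u v : 'rV[R]_n) (w : 'rV[R]_n -> 'rV[R]_r).

Lemma smooth_on_lineproj U w : open U -> smooth_on U w ->
  (forall x, U x -> w x != 0) -> smooth_on U (fun x => lineproj (w x)).
Proof.
move=> oU sw w0 i j k.
apply: (Ck_ext (f := fun x => (\sum_l w x 0 l * w x 0 l)^-1 *
    \sum_(a < d) (w x *m J a) 0 i * (w x *m J a) 0 j)).
  move=> x; rewrite /lineproj [RHS]mxE summxE -dotvE; congr (_ * _).
  by apply: eq_bigr => a _; rewrite [RHS]mxE big_ord1 [X in _ = X * _]mxE.
apply: CkM => //.
  apply: CkV => //.
    by move=> x /w0; rewrite -dotvE dotv_eq0.
  by apply: Ck_sum => // l _; apply: CkM.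
apply: Ck_sum => // a _; apply: CkM => //; apply: smooth_onM => //;
  exact: smooth_on_cst.
Qed.

Lemma oproj_kline (w v : 'M[R]_(N, d)) : mxvec w != 0 ->
  oproj (@dotK R K N) (kline w) v = vec_mx (mxvec v *m lineproj (mxvec w)).
Proof.
move=> w0; apply: oproj_unique.
- by move=> x y z; rewrite !dotK_mxvec linearB dotvBl.
- move=> x; rewrite dotK_mxvec => /eqP; rewrite dotv_eq0 => /eqP x0.
  by rewrite -[x]mxvecK x0 linear0.
- move=> x y [s ->] [t ->]; exists (s - t).
  apply: (can_inj mxvecK); rewrite linearB /= !mxvec_kscale -mulmxBr.
  have := kactP (N := N) (-1) t s.
  by rewrite !scaleN1r [- t + s]addrC [- kact t + _]addrC => ->.
- have [s E] := lineproj_range (mxvec w) (mxvec v); exists s.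
  by apply: (can_inj mxvecK); rewrite vec_mxK E mxvec_kscale.
move=> _ [s ->]; rewrite dotK_mxvec linearB /= vec_mxK mxvec_kscale.
by rewrite dotvBl dotv_mul lineproj_tr lineproj_kact// subrr.
Qed.

Lemma kline_lineproj (w v : 'M[R]_(N, d)) : mxvec w != 0 ->
  kline w v <-> mxvec v *m lineproj (mxvec w) = mxvec v.
Proof.
move=> w0; split => [[s ->]|h]; first by rewrite mxvec_kscale lineproj_kact.
have [s E] := lineproj_range (mxvec w) (mxvec v); exists s.
by apply: (can_inj mxvecK); rewrite mxvec_kscale -E.
Qed.

Section AtPoint.
Variables (w : 'rV[R]_n -> 'rV[R]_r) (x : 'rV[R]_n).
Hypotheses (sw : smooth_near x w) (w0 : forall y, w y != 0).
Local Notation P := (fun y => lineproj (w y)).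

Lemma smooth_near_lineproj : smooth_near x P.
Proof.
have [U [oU Ux Uw]] := sw; exists U; split => //.
by apply: smooth_on_lineproj.
Qed.

Let sP := smooth_near_lineproj.

Lemma lineproj_deriv_sym u : (dmx P x u)^T = dmx P x u.
Proof.
rewrite -(dmx_lin trmx); last exact: smooth_near_mdiff.
by apply: eq_dmx => y; exact: lineproj_tr.
Qed.

Lemma equivariant_dmx (F : 'rV[R]_n -> 'M[R]_r) u : mdiff F x ->
  (forall y, equivariant (F y)) -> equivariant (dmx F x u).
Proof.
move=> dF eF a ad; rewrite -[LHS](dmx_lin (mulmxr (J a)))//.
rewrite -[RHS](dmx_lin (mulmx (J a)))//.
by apply: eq_dmx => y; exact: eF.
Qed.

Lemma tangent_lineproj u : tangent (lineproj (w x)) (dmx P x u).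
Proof.
have dP := smooth_near_mdiff sP.
split; first exact: lineproj_deriv_sym.
  by apply: equivariant_dmx => // y; exact: lineproj_equivariant.
rewrite -dmxM//; apply: eq_dmx => y; exact/esym/lineproj_idem.
Qed.

(** From [w P = w]: evaluated at [w], the derivative of the projector is the horizontal part of the
    variation of [w], its image in Hom(sigma, sigma^perp). *)
Lemma lineproj_deriv_gen u :
  w x *m dmx P x u = dmx w x u *m (1%:M - lineproj (w x)).
Proof.
have dP := smooth_near_mdiff sP; have dw := smooth_near_mdiff sw.
have : dmx (fun y => w y *m P y) x u = dmx w x u.
  by apply: eq_dmx => y; exact: lineproj_gen.
by rewrite dmxM// mulmxBr mulmx1 => {1}<-; rewrite [RHS]addrC addKr.
Qed.

End AtPoint.

(** Symmetry and equivariance are linear conditions and pass to every derivative, unlike the third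
    condition of [tangent]. *)
Lemma lineproj_deriv2 w x u v : smooth_near x w -> (forall y, w y != 0) ->
  let S := dmx (fun y => dmx (fun z => lineproj (w z)) y v) x u in
  S^T = S /\ equivariant S.
Proof.
move=> sw w0 S; have sP := smooth_near_lineproj sw w0.
have dP := smooth_near_mdiff (smooth_near_dmx v sP).
split.
  rewrite -(dmx_lin trmx)//; apply: near_eq_dmx.
  have := smooth_near_nbhs sw; apply: filterS => y swy.
  exact: lineproj_deriv_sym.
move=> a ad; rewrite -[LHS](dmx_lin (mulmxr (J a)))//.
rewrite -[RHS](dmx_lin (mulmx (J a)))//; apply: near_eq_dmx.
have := smooth_near_nbhs sw; apply: filterS => y swy.
by have [_ + _] := tangent_lineproj swy w0 v; apply.
Qed.

End LineField.

(** * Inhomogeneous coordinates and the metric of projective space *)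

Section AffineChart.
Context {R : realType} {K : scalars} {m : nat}.
Local Notation d := (kdim K).
Local Notation q := (m * d)%N.
Local Notation r := (m.+1 * d)%N.
Variable i : 'I_m.+1.
Implicit Types (z u v : 'rV[R]_q).

Lemma kmul1l (s : 'rV[R]_d) : kmul (kbasis R K 0) s = s.
Proof.
case: K s => s; apply/rowP.
  by move=> -[[|[|//]] h]; rewrite !mxE /= !(mul0r, mul1r, oppr0, add0r, addr0);
    congr (s 0 _); exact: val_inj.
by move=> -[[|[|[|[|//]]]] h];
  rewrite !mxE /= !(mul0r, mul1r, oppr0, add0r, addr0);
  congr (s 0 _); exact: val_inj.
Qed.

(** Deletion of row [i] as a left multiplication; the transpose inserts a zero row, which exhibits
    [aff i] as an affine map. *)
Definition drop_row : 'M[R]_(m, m.+1) := \matrix_(j, k) (k == lift i j)%:R.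

Lemma drop_rowE p (V : 'M[R]_(m.+1, p)) : drop_row *m V = row' i V.
Proof.
apply/matrixP => j a; rewrite !mxE (bigD1 (lift i j))//= big1 ?addr0 => [|k kj].
  by rewrite mxE eqxx mul1r.
by rewrite mxE (negbTE kj) mul0r.
Qed.

Lemma insert_rowE p (V : 'M[R]_(m, p)) k a :
  (drop_row^T *m V) k a = if unlift i k is Some j then V j a else 0.
Proof.
rewrite mxE; case: unliftP => [j ->|->].
  rewrite (bigD1 j)//= big1 ?addr0 => [|l lj]; first by rewrite !mxE eqxx mul1r.
  by rewrite !mxE (inj_eq lift_inj) eq_sym (negbTE lj) mul0r.
by rewrite big1// => j _; rewrite !mxE (negbTE (neq_lift i j)) mul0r.
Qed.

Lemma insert_rowK p (V : 'M[R]_(m, p)) : drop_row *m (drop_row^T *m V) = V.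
Proof.
rewrite drop_rowE; apply/matrixP => j a.
by rewrite mxE insert_rowE liftK.
Qed.

Lemma insert_row_drop p (V : 'M[R]_(m.+1, p)) : row i V = 0 ->
  drop_row^T *m (drop_row *m V) = V.
Proof.
move=> Vi; apply/matrixP => k a; rewrite insert_rowE drop_rowE.
case: unliftP => [j ->|->]; first by rewrite mxE.
by have /rowP/(_ a) := Vi; rewrite !mxE.
Qed.

Lemma row_insert p (V : 'M[R]_(m, p)) : row i (drop_row^T *m V) = 0.
Proof. by apply/rowP => a; rewrite [LHS]mxE insert_rowE unlift_none [RHS]mxE. Qed.

Definition chart_lift z : 'rV[R]_r := mxvec (aff i z : 'M[R]_(m.+1, d)).

Definition chart_diff u : 'rV[R]_r := mxvec (drop_row^T *m vec_mx u).

Lemma row_aff z : row i (aff i z : 'M[R]_(m.+1, d)) = kbasis R K 0.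
Proof. by apply/rowP => a; rewrite [LHS]mxE [LHS]mxE unlift_none. Qed.

Lemma affE z : aff i z = drop_row^T *m vec_mx z + aff i 0 :> 'M[R]_(m.+1, d).
Proof.
apply/matrixP => k a; rewrite [RHS]mxE insert_rowE [LHS]mxE [X in _ + X]mxE.
by case: (unlift i k) => [j|]; rewrite ?linear0 ?mxE ?addr0 ?add0r.
Qed.

Lemma chart_lift_neq0 z : chart_lift z != 0.
Proof.
apply/eqP => /(congr1 vec_mx); rewrite mxvecK linear0 => h.
have := row_aff z; rewrite h => /rowP/(_ (Ordinal (@kdim_gt0 K))).
by rewrite !mxE => /esym/eqP; rewrite oner_eq0.
Qed.

Lemma chart_liftE z : chart_lift z = chart_diff z + chart_lift 0.
Proof. by rewrite /chart_lift affE linearD. Qed.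

Lemma dmx_aff z u : dmx (aff i : 'rV[R]_q -> 'M[R]_(m.+1, d)) z u =
  drop_row^T *m vec_mx u.
Proof.
have did : mdiff (@id 'rV[R]_q) z by move=> a b; exact: differentiable_coord.
have dvec : mdiff (fun y : 'rV[R]_q => vec_mx y : 'M[R]_(m, d)) z.
  exact: (mdiff_lin vec_mx did).
rewrite (eq_dmx _ _ affE) dmxD; last 2 first.
- exact: (mdiff_lin (mulmx _) dvec).
- exact: mdiff_cst.
rewrite dmx_cst addr0 (dmx_lin (mulmx _) _ dvec) (dmx_lin vec_mx _ did).
by rewrite dmx_id.
Qed.

Lemma mdiff_aff z : mdiff (aff i : 'rV[R]_q -> 'M[R]_(m.+1, d)) z.
Proof.
have did : mdiff (@id 'rV[R]_q) z by move=> a b; exact: differentiable_coord.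
have dvec : mdiff (fun y : 'rV[R]_q => vec_mx y : 'M[R]_(m, d)) z.
  exact: (mdiff_lin vec_mx did).
apply: (near_eq_mdiff (F := fun y =>
    drop_row^T *m (vec_mx y : 'M[R]_(m, d)) + aff i 0)).
  by apply: filterE => y; rewrite -affE.
apply: mdiffD; [exact: (mdiff_lin (mulmx _) dvec)|exact: mdiff_cst].
Qed.

Lemma smooth_on_chart_lift U : open U -> smooth_on U chart_lift.
Proof.
move=> oU; have sid : smooth_on U (@id 'rV[R]_q) by move=> a b k; exact: Ck_coord.
have s1 := smooth_on_lin vec_mx oU sid.
have s2 := smooth_on_lin (mulmx drop_row^T) oU s1.
have s3 := smooth_on_lin mxvec oU s2.
have s4 := smooth_onD oU s3 (smooth_on_cst U (chart_lift 0)).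
by move=> a b k; apply: Ck_ext (s4 a b k) => y; rewrite [in RHS]chart_liftE.
Qed.

Lemma smooth_near_chart_lift z : smooth_near z chart_lift.
Proof. by exists setT; split; [exact: openT| |exact/smooth_on_chart_lift/openT]. Qed.

Lemma dmx_chart_lift z u : dmx chart_lift z u = chart_diff u.
Proof.
by rewrite (dmx_lin mxvec _ (mdiff_aff z)) ?dmx_aff.
Qed.

Definition chart_proj z : 'M[R]_r := lineproj (chart_lift z).

Local Notation P := chart_proj.

Lemma smooth_near_chart_proj z : smooth_near z P.
Proof.
exact: smooth_near_lineproj (smooth_near_chart_lift z) chart_lift_neq0.
Qed.

Lemma tangent_chart_proj z u : tangent (P z) (dmx P z u).
Proof.
exact: tangent_lineproj (smooth_near_chart_lift z) chart_lift_neq0 u.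
Qed.

Lemma chart_proj_deriv z u :
  chart_lift z *m dmx P z u = chart_diff u *m (1%:M - P z).
Proof.
rewrite (lineproj_deriv_gen (smooth_near_chart_lift z) chart_lift_neq0).
by rewrite dmx_chart_lift.
Qed.

(** A variation lying in the line has the form [w s], whose [i]-th component is [s]; but variations
    of inhomogeneous coordinates have [i]-th component 0. *)
Lemma chart_proj_deriv_inj z u : chart_lift z *m dmx P z u = 0 -> u = 0.
Proof.
rewrite chart_proj_deriv mulmxBr mulmx1 => /eqP; rewrite subr_eq0 => /eqP.
have [s ->] := lineproj_range (chart_lift z) (chart_diff u).
rewrite -mxvec_kscale => /(can_inj mxvecK) E.
have s0 : s = 0.
  have := row_insert (vec_mx u : 'M[R]_(m, d)).
  by rewrite E kscaleE row_mul row_aff -kmulE kmul1l.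
have {}E : drop_row^T *m (vec_mx u : 'M[R]_(m, d)) = 0.
  rewrite E s0 kscaleE; have := kmxP (-1) 0 (0 : 'rV[R]_d).
  by rewrite scaler0 addr0 scaleN1r addNr => ->; rewrite mulmx0.
have := insert_rowK (vec_mx u : 'M[R]_(m, d)); rewrite E mulmx0 => /esym u0.
by rewrite -[u]vec_mxK u0 linear0.
Qed.

(** Subtracting from [v] the multiple of [w] by its [i]-th component kills that component and
    changes nothing modulo the line. *)
Lemma chart_proj_deriv_surj z (v : 'rV[R]_r) : v *m P z = 0 ->
  exists u, chart_lift z *m dmx P z u = v.
Proof.
move=> vP; pose V : 'M[R]_(m.+1, d) := vec_mx v.
pose V' := V - kscale (aff i z) (row i V).
have V'i : row i V' = 0.
  apply/rowP => a; rewrite /V' kscaleE linearB /= row_mul row_aff -kmulE kmul1l.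
  by rewrite subrr.
exists (mxvec (drop_row *m V')); rewrite chart_proj_deriv /chart_diff mxvecK.
have E : mxvec V' = v - chart_lift z *m kact (row i V).
  by rewrite /V' linearB /= vec_mxK mxvec_kscale.
rewrite insert_row_drop// E mulmxBr mulmx1 mulmxBl vP sub0r opprK.
by rewrite lineproj_kact ?subrK//; exact: chart_lift_neq0.
Qed.

Lemma chart_diff_acs (a : nat) u : chart_diff (acs a u) =
  chart_diff u *m kact_basis a.+1.
Proof.
by rewrite /chart_diff /acs mxvecK -mxvec_kscale !kscaleE mulmxA.
Qed.

(** Units commute with the projection off the line, so [acs] in coordinates is right multiplication
    on Hom(sigma, sigma^perp) evaluated at [w]. *)
Lemma chart_proj_acs (a : nat) z u : (a.+1 < d)%N ->
  chart_lift z *m dmx P z (acs a u) =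
  chart_lift z *m dmx P z u *m kact_basis a.+1.
Proof.
move=> ad; apply: (etrans (chart_proj_deriv z (acs a u))).
have -> := chart_proj_deriv z u.
have E : (1%:M - P z) *m kact_basis a.+1 = kact_basis a.+1 *m (1%:M - P z).
  exact: (equivariant_compl (chart_lift_neq0 z)).
rewrite chart_diff_acs; move: (chart_diff u) (1%:M - P z) E => D Q E.
by rewrite -mulmxA -E mulmxA.
Qed.

Lemma fs_metricE kappa z : fs_metric kappa i z =
  trace_metric P (kappa / (2 * d%:R)) z.
Proof.
apply/matrixP => a b; rewrite mxE [RHS]mxE.
have w0 := chart_lift_neq0 z.
rewrite (trace_tangent w0 (tangent_chart_proj z _) (tangent_chart_proj z _)).
have perpE j : mxvec (dmx (aff i) z (delta_mx 0 j) -
      oproj (@dotK R K m.+1) (kline (aff i z)) (dmx (aff i) z (delta_mx 0 j))) =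
    chart_lift z *m dmx P z (delta_mx 0 j).
  rewrite oproj_kline// linearB /= vec_mxK chart_proj_deriv dmx_aff.
  by rewrite mulmxBr mulmx1.
have dotE (A B W : 'M[R]_(m.+1, d)) x y : mxvec A = x -> mxvec B = y ->
    kappa * dotK A B / dotK W W = kappa * dotv x y / dotv (mxvec W) (mxvec W).
  by move=> <- <-; rewrite !dotK_mxvec.
apply: (etrans (dotE _ _ _ _ _ (perpE a) (perpE b))); rewrite -/(chart_lift z).
have n0 : dotv (chart_lift z) (chart_lift z) != 0 by rewrite dotv_eq0.
have d0 : d%:R != 0 :> R by rewrite pnatr_eq0 -lt0n kdim_gt0.
by move: (dotv _ _) (dotv _ _) n0 => n c n0; field; rewrite n0 d0.
Qed.

End AffineChart.

(** * Immersions into projective space *)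

Section BilinearForm.
Context {R : realType} {n : nat}.
Implicit Types (G : 'M[R]_n) (u v w : 'rV[R]_n).

Lemma bformDl G u v w : bform G (u + v) w = bform G u w + bform G v w.
Proof. by rewrite /bform !mulmxDl mxE. Qed.

Lemma bformZl G a u w : bform G (a *: u) w = a * bform G u w.
Proof. by rewrite /bform -!scalemxAl mxE. Qed.

Lemma bformBl G u v w : bform G (u - v) w = bform G u w - bform G v w.
Proof. by rewrite bformDl -scaleN1r bformZl mulN1r. Qed.

Lemma bformDr G u v w : bform G w (u + v) = bform G w u + bform G w v.
Proof. by rewrite /bform linearD mulmxDr mxE. Qed.

Lemma bformZr G a u w : bform G w (a *: u) = a * bform G w u.
Proof. by rewrite /bform linearZ -scalemxAr mxE. Qed.

Lemma bformBr G u v w : bform G w (u - v) = bform G w u - bform G w v.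
Proof. by rewrite bformDr -scaleN1r bformZr mulN1r. Qed.

Lemma bform0r G w : bform G w 0 = 0.
Proof. by rewrite -(scale0r 0) bformZr mul0r. Qed.

Lemma bform_sumr G (I : Type) (s : seq I) (F : I -> 'rV[R]_n) w :
  bform G w (\sum_(a <- s) F a) = \sum_(a <- s) bform G w (F a).
Proof.
elim: s => [|a s IH]; first by rewrite !big_nil bform0r.
by rewrite !big_cons bformDr IH.
Qed.

Definition definite G := forall u, bform G u u = 0 -> u = 0.

Lemma definite_unitmx G : definite G -> G \in unitmx.
Proof.
move=> dG; rewrite -row_free_unit; apply: inj_row_free => u uG.
by apply: dG; rewrite /bform uG mul0mx mxE.
Qed.

Lemma definite_eq G u v : definite G ->
  (forall w, bform G u w = bform G v w) -> u = v.
Proof.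
move=> dG uv; apply/eqP; rewrite -subr_eq0; apply/eqP/dG.
by rewrite bformBl uv subrr.
Qed.

(** Riesz representation; it supplies tangential parts and shape operators. *)
Lemma definite_represent G (l : 'rV[R]_n -> R) : definite G ->
  (forall a u v, l (a *: u + v) = a * l u + l v) ->
  exists s, forall v, bform G s v = l v.
Proof.
move=> dG lP; exists ((\row_j l (delta_mx 0 j)) *m invmx G) => v.
have l0 : l 0 = 0.
  by have := lP (-1) 0 0; rewrite scaler0 addr0 mulN1r addNr.
rewrite /bform mulmxKV ?definite_unitmx// mxE [in RHS](row_sum_delta v).
have -> : l (\sum_j v 0 j *: delta_mx 0 j) = \sum_j v 0 j * l (delta_mx 0 j).
  elim: (index_enum _) => [|j s IH]; first by rewrite !big_nil.
  by rewrite !big_cons lP IH.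
by apply: eq_bigr => j _; rewrite !mxE mulrC.
Qed.

End BilinearForm.

Lemma near_eq_christoffel_map (R : realType) (n : nat)
    (g g' : 'rV[R]_n -> 'M[R]_n) x u v : (\forall y \near x, g y = g' y) ->
  christoffel_map g x u v = christoffel_map g' x u v.
Proof.
move=> gg'; have E l i j : dmetric g x l i j = dmetric g' x l i j.
  by apply: near_eq_derive; apply: filterS gg' => y ->.
have Ec i j k : christoffel g x i j k = christoffel g' x i j k.
  rewrite /christoffel (nbhs_singleton gg'); congr (_ * _).
  by apply: eq_bigr => l _; rewrite !E.
apply/rowP => k; rewrite [LHS]mxE [RHS]mxE.
by apply: eq_bigr => i _; apply: eq_bigr => j _; rewrite Ec.
Qed.

(** * Second fundamental form and the derivative of the curvature *)

Section Submanifold.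
Context {R : realType} {K : scalars} {m n : nat}.
Local Notation d := (kdim K).
Local Notation q := (m * d)%N.
Local Notation r := (m.+1 * d)%N.
Variables (i : 'I_m.+1) (kappa : R) (f : 'rV[R]_n -> 'rV[R]_q) (x : 'rV[R]_n).
Hypotheses (kappa_gt0 : 0 < kappa) (sf : smooth_near x f)
  (finj : injective (dmx f x)).
Implicit Types (u v c : 'rV[R]_n) (xi eta : 'rV[R]_q).

Local Notation h := (fs_metric (K := K) kappa i).
Local Notation hx := (bform (h (f x))).
Local Notation g := (pullback_metric h f).
Local Notation lam := (kappa / (2 * d%:R)).
Local Notation PP := (chart_proj (R := R) (K := K) i).
Local Notation F := (fun y => chart_proj (R := R) (K := K) i (f y)).
Local Notation w := (chart_lift (R := R) (K := K) i (f x)).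
Local Notation D2F c u := (dmx (fun y => dmx F y u) x c).

Let df : mdiff f x. Proof. exact: smooth_near_mdiff. Qed.

Lemma fs_metric_fun : h = trace_metric PP lam.
Proof. by apply/funext => z; rewrite fs_metricE. Qed.

Lemma bform_fs (z xi eta : 'rV[R]_q) : bform (h z) xi eta =
  lam * \tr (dmx PP z xi *m dmx PP z eta).
Proof.
by rewrite fs_metricE; apply: bform_trace_metric; exact: smooth_near_chart_proj.
Qed.

Lemma bform_fsC (z xi eta : 'rV[R]_q) : bform (h z) xi eta = bform (h z) eta xi.
Proof.
rewrite (bform_fs z xi eta) (bform_fs z eta xi).
by move: (dmx _ _ xi) (dmx _ _ eta) => A B; rewrite mxtrace_mulC.
Qed.

Lemma bform_fs_gen (z xi eta : 'rV[R]_q) : bform (h z) xi eta =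
  kappa / dotv (chart_lift i z) (chart_lift i z) *
  dotv (chart_lift i z *m dmx PP z xi) (chart_lift i z *m dmx PP z eta).
Proof.
have w0 := chart_lift_neq0 (R := R) (K := K) i z.
rewrite bform_fs.
rewrite (trace_tangent w0 (tangent_chart_proj i z xi) (tangent_chart_proj i z eta)).
have n0 : dotv (chart_lift (K := K) i z) (chart_lift i z) != 0 by rewrite dotv_eq0.
have d0 : d%:R != 0 :> R by rewrite pnatr_eq0 -lt0n kdim_gt0.
by move: (dotv _ _) (dotv _ _) n0 => a b b0; field; rewrite b0 d0.
Qed.

Lemma fs_definite z : definite (h z).
Proof.
move=> u; rewrite bform_fs_gen => /eqP; rewrite !mulf_eq0 invr_eq0 !dotv_eq0.
rewrite (gt_eqF kappa_gt0) (negbTE (chart_lift_neq0 i z)) /= => /eqP.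
exact: chart_proj_deriv_inj.
Qed.

Lemma smooth_near_lift : smooth_near x (fun y => chart_lift (K := K) i (f y)).
Proof.
have s1 := smooth_near_lin vec_mx sf.
have s2 := smooth_near_lin (mulmx (drop_row i)^T) s1.
have s3 := smooth_near_lin mxvec s2.
have s4 := smooth_nearD s3 (smooth_near_cst (chart_lift i 0) x).
by apply: smooth_near_eq s4; apply: filterE => y; rewrite [RHS]chart_liftE.
Qed.

Lemma smooth_near_proj : smooth_near x F.
Proof.
by apply: smooth_near_lineproj smooth_near_lift _ => y; exact: chart_lift_neq0.
Qed.

Lemma dmx_proj u : dmx F x u = dmx PP (f x) (dmx f x u).
Proof.
apply: (dmx_comp df); apply: smooth_near_mdiff; exact: smooth_near_chart_proj.
Qed.

(** The chain rule holds where [f] is differentiable; equality near [x] suffices for the Christoffel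
    symbols at [x]. *)
Lemma pullback_near : \forall y \near x, g y = trace_metric F lam y.
Proof.
apply: filterS (smooth_near_nbhs sf) => y /smooth_near_mdiff dfy.
apply/matrixP => j k; rewrite [LHS]mxE [RHS]mxE bform_fs.
have dP := smooth_near_mdiff (smooth_near_chart_proj i (f y)).
by rewrite !(dmx_comp dfy _ dP).
Qed.

Lemma smooth_near_pullback : smooth_near x g.
Proof.
apply: smooth_near_eq (smooth_near_trace_metric lam smooth_near_proj).
by apply: filterS pullback_near => y ->.
Qed.

Lemma bform_pullback u v : bform (g x) u v = hx (dmx f x u) (dmx f x v).
Proof.
rewrite (nbhs_singleton pullback_near) (bform_trace_metric _ smooth_near_proj).
by rewrite bform_fs !dmx_proj.
Qed.

Lemma pullback_definite : definite (g x).
Proof.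
move=> u; rewrite bform_pullback => /fs_definite fu.
by apply: finj; rewrite fu dmx0v.
Qed.

Lemma christoffel_pullback c u v :
  bform (g x) (christoffel_map g x c u) v = lam * \tr (D2F c u *m dmx F x v).
Proof.
rewrite (near_eq_christoffel_map _ _ pullback_near) (nbhs_singleton pullback_near).
apply: christoffel_trace_metric; first exact: smooth_near_proj.
by rewrite -(nbhs_singleton pullback_near); exact/definite_unitmx/pullback_definite.
Qed.

(** The second derivative of the composite splits into the ambient second derivative, which accounts
    for the Christoffel term, and the derivative of [df u]. *)
Lemma covd_along_fs c u eta :
  hx (covd_along h f (fun y => dmx f y u) x c) eta =
  lam * \tr (D2F c u *m dmx PP (f x) eta).
Proof.
have sPP := smooth_near_chart_proj (R := R) (K := K) i (f x).
have dV := smooth_near_mdiff (smooth_near_dmx u sf).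
have -> : D2F c u = dmx (fun z => dmx PP z (dmx f x u)) (f x) (dmx f x c) +
    dmx PP (f x) (dmx (fun y => dmx f y u) x c).
  apply: (etrans _ (dmx_dmx_comp c sPP df dV)); apply: near_eq_dmx.
  apply: filterS (smooth_near_nbhs sf) => y /smooth_near_mdiff dfy.
  apply: (dmx_comp dfy); apply: smooth_near_mdiff; exact: smooth_near_chart_proj.
rewrite /covd_along bformDl addrC mulmxDl linearD /= mulrDr; congr (_ + _).
  rewrite fs_metric_fun; apply: christoffel_trace_metric => //.
  by rewrite -fs_metricE; exact/definite_unitmx/fs_definite.
exact: bform_fs.
Qed.

Lemma proj_deriv2_sym c u : (D2F c u)^T = D2F c u.
Proof.
have w0 y : chart_lift (R := R) (K := K) i (f y) != 0 by exact: chart_lift_neq0.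
by have [] := lineproj_deriv2 c u smooth_near_lift w0.
Qed.

Lemma proj_deriv2_equivariant c u : equivariant (D2F c u).
Proof.
have w0 y : chart_lift (R := R) (K := K) i (f y) != 0 by exact: chart_lift_neq0.
by have [] := lineproj_deriv2 c u smooth_near_lift w0.
Qed.

(** The block is the derivative of the projector along some [eta], by surjectivity; traces against
    tangent matrices and definiteness identify [eta] with the covariant derivative. *)
Lemma proj_deriv2_gen c u :
  w *m D2F c u *m (1%:M - PP (f x)) =
  w *m dmx PP (f x) (covd_along h f (fun y => dmx f y u) x c).
Proof.
have w0 := chart_lift_neq0 (R := R) (K := K) i (f x).
have [|eta eta_eq] := @chart_proj_deriv_surj R K m i (f x)
    (w *m D2F c u *m (1%:M - PP (f x))).
  by rewrite -mulmxA mulmxBl mul1mx lineproj_idem// subrr mulmx0.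
suff -> : covd_along h f (fun y => dmx f y u) x c = eta by [].
apply: (definite_eq (G := h (f x))); first exact: fs_definite.
move=> v; rewrite covd_along_fs (bform_fs (f x) eta v); congr (_ * _).
exact: (trace_mul_offdiag w0 (proj_deriv2_sym c u) (proj_deriv2_equivariant c u)
  (tangent_chart_proj i (f x) eta) (tangent_chart_proj i (f x) v) (esym eta_eq)).
Qed.

Lemma normal_part_unique xi s :
  (forall v, hx (xi - dmx f x s) (dmx f x v) = 0) ->
  normal_part h f x xi = xi - dmx f x s.
Proof.
move=> xiP; rewrite /normal_part; congr (_ - _); apply: oproj_unique.
- by move=> a b e; rewrite bformBl.
- exact: fs_definite.
- by move=> _ _ [a _ <-] [b _ <-]; exists (a - b) => //; rewrite dmxBv.
- by exists s.
- by move=> _ [v _ <-].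
Qed.

Lemma normal_partP xi : exists s, normal_part h f x xi = xi - dmx f x s /\
  forall v, hx (normal_part h f x xi) (dmx f x v) = 0.
Proof.
have [|s sP] := definite_represent (l := fun v => hx xi (dmx f x v))
  pullback_definite.
  by move=> a u v; rewrite dmxP// bformDr bformZr.
have xiP v : hx (xi - dmx f x s) (dmx f x v) = 0.
  by rewrite bformBl -bform_pullback sP subrr.
by exists s; rewrite (normal_part_unique xiP).
Qed.

(** Gauss formula: against tangent vectors both terms pair as the same trace with the second
    derivative of [F]. *)
Lemma second_ffE c u : second_ff h f x c u =
  covd_along h f (fun y => dmx f y u) x c - dmx f x (christoffel_map g x c u).
Proof.
apply: normal_part_unique => v; rewrite bformBl covd_along_fs.
by rewrite -bform_pullback christoffel_pullback dmx_proj subrr.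
Qed.

Lemma second_ff_normal c u v : hx (second_ff h f x c u) (dmx f x v) = 0.
Proof.
by have [s [_]] := normal_partP (covd_along h f (fun y => dmx f y u) x c); apply.
Qed.

Lemma second_ff_normal_part c u eta :
  hx (second_ff h f x c u) (normal_part h f x eta) = hx (second_ff h f x c u) eta.
Proof.
by have [s [-> _]] := normal_partP eta; rewrite bformBr second_ff_normal subr0.
Qed.

Lemma second_ff_trace c u eta : hx (second_ff h f x c u) eta =
  lam * \tr (D2F c u *m dmx PP (f x) (normal_part h f x eta)).
Proof.
rewrite -second_ff_normal_part second_ffE bformBl covd_along_fs.
rewrite [X in _ - X]bform_fsC; have [s [_ ->]] := normal_partP eta.
by rewrite subr0.
Qed.

Lemma second_ffC c u : second_ff h f x c u = second_ff h f x u c.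
Proof.
apply: (definite_eq (G := h (f x))); first exact: fs_definite.
move=> eta; apply: (etrans (second_ff_trace c u eta)).
apply: (etrans _ (esym (second_ff_trace u c eta))).
exact: (congr1 (fun A => lam * \tr (A *m _)) (dmx_comm c u smooth_near_proj)).
Qed.

(** Symmetry of second derivatives moves the varying vector into the direction of differentiation,
    where linearity is known. This yields the existence of [shape]. *)
Lemma second_ff_linear c eta a u v :
  hx (second_ff h f x c (a *: u + v)) eta =
  a * hx (second_ff h f x c u) eta + hx (second_ff h f x c v) eta.
Proof.
have E b : hx (second_ff h f x c b) eta = lam *
    \tr (dmx (fun y => dmx F y c) x b *m
         dmx PP (f x) (normal_part h f x eta)).
  apply: (etrans (second_ff_trace c b eta)).
  exact: (congr1 (fun A => lam * \tr (A *m _)) (dmx_comm c b smooth_near_proj)).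
have dFc := smooth_near_mdiff (smooth_near_dmx c smooth_near_proj).
apply: (etrans (E _)); apply: (etrans _
  (esym (congr2 (fun s t => a * s + t) (E u) (E v)))).
apply: (etrans (congr1 (fun A => lam * \tr (A *m _)) (dmxP a u v dFc))).
move: (dmx _ x u) (dmx _ x v) (dmx PP _ _) => A B T.
by rewrite mulmxDl -scalemxAl linearD linearZ /=; ring.
Qed.

Lemma shapeP eta u v : bform (g x) (Defs.shape h f x eta u) v =
  hx (second_ff h f x u v) eta.
Proof.
have [s sP] := definite_represent pullback_definite (second_ff_linear u eta).
exact: (@xgetPex _ 0 [set s | forall v, bform (g x) s v =
  hx (second_ff h f x u v) eta] (ex_intro _ s sP) v).
Qed.

(** The form of the theorem for one unit; normal parts are omitted because the second fundamental
    form is already normal. *)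
Definition shape_component (a : nat) u v c : R :=
  hx (second_ff h f x c v) (acs a (dmx f x u)) -
  hx (second_ff h f x c u) (acs a (dmx f x v)).

Lemma shape_span (t : 'I_d.-1 -> R) u v c :
  bform (g x)
    (Defs.shape h f x (normal_part h f x (acs_span t (dmx f x u))) v -
     Defs.shape h f x (normal_part h f x (acs_span t (dmx f x v))) u) c =
  \sum_a t a * shape_component a u v c.
Proof.
have shape_sum u' v' : bform (g x)
    (Defs.shape h f x (normal_part h f x (acs_span t (dmx f x u'))) v') c =
    \sum_a t a * hx (second_ff h f x c v') (acs a (dmx f x u')).
  apply: (etrans (shapeP _ _ _)); apply: (etrans (second_ff_normal_part _ _ _)).
  apply: (etrans (congr1 (fun xi => hx xi _) (second_ffC v' c))).
  apply: (etrans (bform_sumr _ _ _ _)); apply: eq_bigr => a _; exact: bformZr.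
apply: (etrans (bformBl _ _ _ _)).
apply: (etrans (congr2 (fun a b => a - b) (shape_sum u v) (shape_sum v u))).
by rewrite -sumrB; apply: eq_bigr => a _; rewrite -mulrBr.
Qed.

Lemma bform_acs_gen (a : nat) xi eta : (a.+1 < d)%N -> hx (acs a xi) eta =
  kappa / dotv w w *
  dotv (w *m dmx PP (f x) xi *m kact_basis a.+1) (w *m dmx PP (f x) eta).
Proof.
move=> ad; apply: (etrans (bform_fs_gen (f x) (acs a xi) eta)).
exact: (congr1 (fun e => _ * dotv e _) (chart_proj_acs i (f x) xi ad)).
Qed.

Lemma bform_acs (a : nat) xi eta : (a.+1 < d)%N ->
  hx (acs a xi) eta = - hx (acs a eta) xi.
Proof.
move=> ad; apply: (etrans (bform_acs_gen xi eta ad)).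
apply: (etrans _ (esym (congr1 -%R (bform_acs_gen eta xi ad)))).
have flip k (A B : 'rV[R]_r) : k * dotv (A *m kact_basis a.+1) B =
    - (k * dotv (B *m kact_basis a.+1) A).
  by rewrite dotv_mul kact_basis_tr// mulmxN dotvNr mulrN dotvC.
exact: flip.
Qed.

(** The factor [2 / |w|^2] of [curvature_form_gen] divided by the factor [kappa / |w|^2] of the
    metric gives [2 / kappa], independent of the generator. *)
Lemma curvature_form_acs xi eta :
  w *m curvature_form (dmx PP (f x) xi) (dmx PP (f x) eta) =
  \sum_(a < d.-1) (2 / kappa * hx (acs a xi) eta) *: (w *m kact_basis a.+1).
Proof.
have w0 := chart_lift_neq0 (R := R) (K := K) i (f x).
have n0 : dotv w w != 0 by rewrite dotv_eq0.
have k0 : kappa != 0 by rewrite gt_eqF.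
apply: (etrans (curvature_form_gen w0 (tangent_chart_proj i (f x) xi)
  (tangent_chart_proj i (f x) eta))).
apply: eq_bigr => a _; congr (_ *: _).
have ad : (a.+1 < d)%N by rewrite -ltn_predRL.
apply: (etrans _ (esym (congr1 ( *%R _) (bform_acs_gen xi eta ad)))).
have cancel b e : b != 0 -> 2 / b * e = 2 / kappa * (kappa / b * e).
  by move=> b0; field; rewrite b0 k0.
exact: cancel.
Qed.

(** R(II(c, u), v) + R(u, II(c, v)), with R the curvature of the universal connection. *)
Definition normal_curvature u v c : 'M[R]_r :=
  curvature_form (dmx PP (f x) (second_ff h f x c u))
    (dmx PP (f x) (dmx f x v)) +
  curvature_form (dmx PP (f x) (dmx f x u))
    (dmx PP (f x) (second_ff h f x c v)).

Lemma normal_curvature_gen u v c : w *m normal_curvature u v c =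
  \sum_(a < d.-1) (2 / kappa * shape_component a u v c) *:
    (w *m kact_basis a.+1).
Proof.
apply: (etrans (mulmxDr _ _ _)).
apply: (etrans (congr2 +%R (curvature_form_acs (second_ff h f x c u) (dmx f x v))
  (curvature_form_acs (dmx f x u) (second_ff h f x c v)))).
apply: (etrans (esym (big_split _ _ _ _ _))); apply: eq_bigr => a _ /=.
have ad : (a.+1 < d)%N by rewrite -ltn_predRL.
have comb k (V : 'rV[R]_r) p1 p2 q1 q2 : p1 = - q1 -> p2 = q2 ->
    (k * p1) *: V + (k * p2) *: V = (k * (q2 - q1)) *: V.
  by move=> -> ->; rewrite -scalerDl; congr (_ *: _); ring.
apply: comb; last exact: bform_fsC.
apply: (etrans (bform_acs _ _ ad)); congr (- _); exact: bform_fsC.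
Qed.

Lemma equivariant_normal_curvature u v c : equivariant (normal_curvature u v c).
Proof.
have tPP eta : equivariant (dmx PP (f x) eta).
  by have [] := tangent_chart_proj (R := R) (K := K) i (f x) eta.
by apply: equivariantD; exact: equivariant_curvature_form.
Qed.

Lemma normal_curvature_eq0 u v c :
  w *m normal_curvature u v c = 0 <->
  forall a : 'I_d.-1, shape_component a u v c = 0.
Proof.
have n0 : dotv w w != 0 by rewrite dotv_eq0 chart_lift_neq0.
have k0 : 2 / kappa != 0.
  by rewrite mulf_neq0 ?pnatr_eq0 ?invr_neq0 ?(gt_eqF kappa_gt0).
rewrite normal_curvature_gen; split => [h0 b|h0]; last first.
  by rewrite big1// => a _; rewrite h0 mulr0 scale0r.
have bd : (b.+1 < d)%N by rewrite -ltn_predRL.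
have := congr1 (fun e => dotv e (w *m kact_basis b.+1)) h0.
rewrite dotv0l dotv_suml (bigD1 b)//= big1 ?addr0 => [|a ab].
  rewrite dotvZl dotv_kact_orthogonal// eqxx mulr1 => /eqP.
  by rewrite mulf_eq0 (negbTE n0) orbF mulf_eq0 (negbTE k0) => /eqP.
rewrite dotvZl dotv_kact_orthogonal//; last by rewrite -ltn_predRL.
by rewrite eqSS (_ : (_ == _) = false) ?mulr0//; exact/negbTE.
Qed.

(** Every vector of the fibre is [w s], and [s] can be moved past an equivariant matrix. *)
Lemma normal_curvature_fibre u v c (om : 'rV[R]_r) : om *m PP (f x) = om ->
  w *m normal_curvature u v c = 0 -> om *m normal_curvature u v c = 0.
Proof.
move=> omP C0; have [s] := lineproj_range w om.
rewrite -/(PP (f x)) omP => ->; rewrite kact_sum mulmx_sumr mulmx_suml.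
rewrite big1// => a _; rewrite -scalemxAr -scalemxAl -mulmxA.
by rewrite -(equivariant_normal_curvature u v c)// mulmxA C0 mul0mx scaler0.
Qed.

Lemma normal_curvatureE u v c (om : 'rV[R]_r) : om *m PP (f x) = om ->
  om *m ((D2F c v *m dmx F x u + dmx F x v *m D2F c u -
          (D2F c u *m dmx F x v + dmx F x u *m D2F c v)) *m PP (f x) -
         curvature_form (dmx F x (christoffel_map g x c u)) (dmx F x v) -
         curvature_form (dmx F x u) (dmx F x (christoffel_map g x c v))) =
  om *m normal_curvature u v c.
Proof.
move=> omP.
have w0 := chart_lift_neq0 (R := R) (K := K) i (f x).
have tPP := tangent_chart_proj (R := R) (K := K) i (f x).
have E := curvature_form_derivative w0 (proj_deriv2_sym c u)
  (proj_deriv2_equivariant c u) (proj_deriv2_sym c v)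
  (proj_deriv2_equivariant c v) (tPP (dmx f x u)) (tPP (dmx f x v))
  (tPP _) (tPP _) (proj_deriv2_gen c u) (proj_deriv2_gen c v).
have dPP : mdiff PP (f x) by exact/smooth_near_mdiff/smooth_near_chart_proj.
have II b : dmx PP (f x) (second_ff h f x c b) =
    dmx PP (f x) (covd_along h f (fun y => dmx f y b) x c) -
    dmx PP (f x) (dmx f x (christoffel_map g x c b)).
  apply: (etrans (congr1 (dmx PP (f x)) (second_ffE c b))); exact: dmxBv.
(* Pure matrix algebra: subtracting the Christoffel terms [G] from the ambient covariant derivatives
   [T] leaves second fundamental forms by the Gauss formula. *)
have combine (SX SY A B A' B' G1 G2 G1' G2' T1 T2 II1 II2 Q : 'M[R]_r) :
    A' = A -> B' = B -> G1' = G1 -> G2' = G2 -> II1 = T1 - G1 ->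
    II2 = T2 - G2 -> om *m Q = om ->
    Q *m (SY *m A + B *m SX - (SX *m B + A *m SY)) *m Q =
    Q *m (curvature_form T1 B + curvature_form A T2) ->
    om *m ((SY *m A' + B' *m SX - (SX *m B' + A' *m SY)) *m Q -
      curvature_form G1' B' - curvature_form A' G2') =
    om *m (curvature_form II1 B + curvature_form A II2).
  move=> -> -> -> -> -> -> omQ EQ.
  rewrite curvature_formBl curvature_formBr.
  have -> : om *m ((SY *m A + B *m SX - (SX *m B + A *m SY)) *m Q -
      curvature_form G1 B - curvature_form A G2) =
    om *m Q *m (SY *m A + B *m SX - (SX *m B + A *m SY)) *m Q -
      om *m curvature_form G1 B - om *m curvature_form A G2.
    by rewrite omQ 2!(mulmxBr om) mulmxA.
  rewrite -(mulmxA om Q) -(mulmxA om (Q *m _)) EQ (mulmxA om Q) omQ.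
  move: (curvature_form T1 B) (curvature_form A T2) => c1 c2.
  move: (curvature_form G1 B) (curvature_form A G2) => c3 c4.
  rewrite -!mulmxBr; congr (_ *m _).
  by apply/matrixP => a b; rewrite !mxE; ring.
exact: (combine _ _ _ _ _ _ _ _ _ _ _ _ _ _ _ (dmx_proj u) (dmx_proj v)
  (dmx_proj _) (dmx_proj _) (II u) (II v) omP E).
Qed.

End Submanifold.

(** * Local form of the two conditions *)

Section LocalSetting.
Context {R : realType} {K : scalars} {m n : nat} {B : topologicalType}.
Variables (M : manifold R n B) (kappa : R) (phi : B -> kproj R K m).
Hypotheses (kappa_gt0 : 0 < kappa) (imm : immersion M phi).
Variables (p : B) (c : chart R n B) (i : 'I_m.+1).
Hypothesis ch : charts_at M phi p c i.

Local Notation x := (ccoord c p).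
Local Notation f := (local_rep phi c i).
Local Notation sigma := (fibre phi c).
Local Notation F := (fun y => chart_proj i (f y)).

Lemma local_rep_smooth : smooth_near x f.
Proof.
by have [/(_ p c i ch) [U [oU Ux _ _ sU]] _] := imm; exists U.
Qed.

Lemma fibre_near : \forall y \near x, sigma y = kline (aff i (f y)).
Proof.
have [/(_ p c i ch) [U [oU Ux _ Udom _]] _] := imm.
apply: filterS (open_nbhs_nbhs (conj oU Ux)) => y /Udom dom.
exact: (@xgetPex _ 0 [set z | sval (phi (cpar c y)) = kline (aff i z)] dom).
Qed.

Lemma local_rep_inj : injective (dmx f x).
Proof. by have [_] := imm; apply. Qed.

Lemma fibre_projection : projection_field sigma F x.
Proof.
split; first exact/smooth_near_proj/local_rep_smooth.
apply: filterS fibre_near => y sy; rewrite /projects_onto sy.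
have w0 := chart_lift_neq0 (R := R) (K := K) i (f y).
split; first exact: lineproj_idem.
- by move=> v; exact: oproj_kline.
- by move=> v; exact: kline_lineproj.
Qed.

(** A nowhere zero local section; evaluating the curvature on it tests the whole fibre. *)
Lemma tautological_section : is_section sigma x (fun y => aff i (f y)).
Proof.
split.
  have := smooth_near_lin vec_mx (smooth_near_lift i local_rep_smooth).
  by apply: smooth_near_eq; apply: filterE => y; exact: mxvecK.
apply: filterS fibre_near => y ->.
apply/(kline_lineproj _ (chart_lift_neq0 i (f y))).
exact/lineproj_gen/chart_lift_neq0.
Qed.

Lemma mxvec_Dcurv_fibre X Y Z W : smooth_near x X -> smooth_near x Y ->
  smooth_near x Z -> is_section sigma x W ->
  mxvec (Dcurv (induced_metric phi kappa c i) sigma Z X Y W x) =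
  mxvec (W x) *m normal_curvature i kappa f x (X x) (Y x) (Z x).
Proof.
move=> sX sY sZ secW; have sf := local_rep_smooth; have finj := local_rep_inj.
have sg := smooth_near_pullback i kappa sf.
have gx := definite_unitmx (pullback_definite kappa_gt0 sf finj).
have pf := fibre_projection.
have sGX := smooth_near_covd sg (gx i) sZ sX.
have sGY := smooth_near_covd sg (gx i) sZ sY.
apply: (etrans (mxvec_Dcurv pf sX sY sZ sGX sGY secW)).
apply: (normal_curvatureE kappa_gt0 sf finj).
have [_ /nbhs_singleton[_ _ h]] := pf; apply/h.
by have [_ /nbhs_singleton] := secW.
Qed.

Lemma shape_form_sum t X Y Z : shape_form phi kappa c i x t X Y Z =
  \sum_a t a * shape_component i kappa f x a X Y Z.
Proof.
exact: (shape_span i kappa_gt0 local_rep_smooth local_rep_inj t X Y Z).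
Qed.

Lemma shape_form_eq0 X Y Z :
  (forall t, shape_form phi kappa c i x t X Y Z = 0) <->
  chart_lift i (f x) *m normal_curvature i kappa f x X Y Z = 0.
Proof.
have E := normal_curvature_eq0 i f x kappa_gt0 X Y Z.
split => [h|/E h t]; last first.
  by rewrite shape_form_sum big1// => a _; rewrite h mulr0.
(* Kronecker coefficients isolate one unit in the real span. *)
apply/E => a; have := h (fun b => (b == a)%:R).
rewrite shape_form_sum (bigD1 a)//= big1 ?addr0 => [|b ba].
  by rewrite eqxx mul1r.
by rewrite (negbTE ba) mul0r.
Qed.

Lemma Dcurv_eq0 X Y Z W : smooth_near x X -> smooth_near x Y ->
  smooth_near x Z -> is_section sigma x W ->
  (forall t, shape_form phi kappa c i x t (X x) (Y x) (Z x) = 0) ->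
  Dcurv (induced_metric phi kappa c i) sigma Z X Y W x = 0.
Proof.
move=> sX sY sZ secW /shape_form_eq0 h; apply: (can_inj mxvecK).
rewrite linear0 mxvec_Dcurv_fibre//; apply: normal_curvature_fibre => //.
have [_ /nbhs_singleton[_ _ fib]] := fibre_projection; apply/fib.
by have [_ /nbhs_singleton] := secW.
Qed.

Lemma shape_form_Dcurv (X Y Z : 'rV[R]_n) :
  Dcurv (induced_metric phi kappa c i) sigma (fun=> Z) (fun=> X) (fun=> Y)
    (fun y => aff i (f y)) x = 0 ->
  forall t, shape_form phi kappa c i x t X Y Z = 0.
Proof.
move=> h; apply/shape_form_eq0.
have := mxvec_Dcurv_fibre (smooth_near_cst X x) (smooth_near_cst Y x)
  (smooth_near_cst Z x) tautological_section.
by rewrite h linear0 => <-.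
Qed.

End LocalSetting.

Theorem theorem1p7 (R : realType) (K : scalars) (m n : nat)
    (B : topologicalType) (M : manifold R n B) (kappa : R)
    (phi : B -> kproj R K m) :
  0 < kappa ->
  compact [set: B] ->
  immersion M phi ->
  (parallel_conn M phi kappa <->
   forall p c i, charts_at M phi p c i ->
   forall (t : 'I_(kdim K).-1 -> R) (X Y Z : 'rV[R]_n),
     shape_form phi kappa c i (ccoord c p) t X Y Z = 0)
  /\
  (radially_symmetric_conn M phi kappa <->
   forall p c i, charts_at M phi p c i ->
   forall (t : 'I_(kdim K).-1 -> R) (X Y : 'rV[R]_n),
     shape_form phi kappa c i (ccoord c p) t X Y X = 0).
Proof.
move=> k0 _ imm; split; split => [H p c i ch t X Y|H p c i ch X Y].
- move=> Z; apply: (shape_form_Dcurv k0 imm ch); apply: (H p c i ch);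
    [exact: smooth_near_cst..|exact: tautological_section ch].
- move=> Z W sX sY sZ secW; apply: (Dcurv_eq0 k0 imm ch) => // t.
  exact: H ch _ _ _ _.
(* The radial statements are the instance [Z = X] of the local lemmas, which treat one triple of
   vectors at a time. *)
- apply: (shape_form_Dcurv k0 imm ch); apply: (H p c i ch);
    [exact: smooth_near_cst..|exact: tautological_section ch].
- move=> W sX sY secW; apply: (Dcurv_eq0 k0 imm ch) => // t.
  exact: H ch _ _ _.
Qed.
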